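(* There is a constant $u_m>0$, only depending on $m$, such that the following holds: for $0<r<1$ fixed, there exist constants $c(r),C(r)>0$ such that, for all $n\geq c(r)k\log(ed/k)$ and $V_1,\dots,V_n\in\mathcal{G}_{m,d}$ independently chosen random subspaces with identical distribution $\sigma_m$, the inequality $$\sum_{i=1}^n \big| x^*A_ix-y^*A_iy \big|\geq u_m (1-r)\,n\,\|xx^*-yy^*\|_{HS},$$ for all $k$-sparse $x,y\in\mathbb{R}^d$, holds with probability of failure at most $e^{-C(r)n}$. Here $A_i=\frac{d}{m}P_{V_i}$ for $i=1,\ldots,n$.
   Context: $\mathcal{G}_{m,d}$ is the manifold of all $m$-dimensional linear subspaces of $\mathbb{R}^d$, endowed with its standard normalized Haar measure $\sigma_m$. $P_V$ denotes the orthogonal projector of $\mathbb{R}^d$ onto the subspace $V$. $\|\cdot\|_{HS}$ is the Hilbert-Schmidt (Frobenius) norm, $x^*$ is the transpose of $x$, and a vector is $k$-sparse if it has at most $k$ nonzero entries. ''With probability of failure at most $q$'' means that the event (here, that the inequality holds simultaneously for all $k$-sparse $x,y$) has probability at least $1-q$.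
   Formalization: The formal theorem assumes 1 ≤ m < d and 1 ≤ k ≤ d; for m = d ≥ 2 every A_i is the identity, so x = e_1, y = e_2 refute the inequality, and k = 0 or m = 0 leaves log(ed/k) or d/m undefined. *)

(* Defs.v *)
From HB Require Import structures.
From mathcomp Require Import all_boot all_order all_algebra.
From mathcomp Require Import all_classical all_reals all_analysis.
Set Implicit Arguments.
Unset Strict Implicit.
Unset Printing Implicit Defensive.
Import Order.TTheory GRing.Theory Num.Theory.
Import numFieldNormedType.Exports.
Local Open Scope classical_set_scope.
Local Open Scope ring_scope.

Section OrthogonalProjector.
Context (R : realType) (d : nat).
Implicit Types (V : {vspace 'cV[R]_d}) (x v : 'cV[R]_d).

Definition basis_mx V : 'M[R]_(d, \dim V) :=
  \matrix_(i < d, j < \dim V) (vbasis V)`_j i 0.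

(* The Gram matrix of a basis is invertible; [orthoproj_mem] and
   [orthoproj_orth] characterise the orthogonal projector onto V. *)
Definition orthoproj V : 'M[R]_d :=
  let B := basis_mx V in B *m invmx (B^T *m B) *m B^T.

Lemma basis_mxE V (c : 'cV[R]_(\dim V)) :
  basis_mx V *m c = \sum_j c j 0 *: (vbasis V)`_j.
Proof.
apply/matrixP => i j; rewrite mxE summxE (ord1 j).
by apply: eq_bigr => k _; rewrite !mxE mulrC.
Qed.

Lemma trmx_mul_eq0 (p : nat) (x : 'cV[R]_p) : x^T *m x = 0 -> x = 0.
Proof.
move=> /matrixP/(_ 0 0); rewrite !mxE => x0.
apply/matrixP => i j; rewrite (ord1 j) [RHS]mxE.
have xsq k : (x^T) 0 k * x k 0 = x k 0 ^+ 2 by rewrite mxE.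
move: x0; rewrite (eq_bigr _ (fun k _ => xsq k)) => /eqP.
rewrite psumr_eq0 => [/allP/(_ i)|k _]; last exact: sqr_ge0.
by rewrite mem_index_enum => /(_ isT); rewrite sqrf_eq0 => /eqP.
Qed.

Lemma gram_unit V : (basis_mx V)^T *m basis_mx V \in unitmx.
Proof.
set B := basis_mx V; rewrite -row_free_unit -kermx_eq0.
apply/eqP/row_matrixP => i; rewrite row0.
set c := row i _.
have cG : c *m (B^T *m B) = 0.
  by apply/sub_kermxP; rewrite row_sub.
have : B *m c^T = 0.
  apply: trmx_mul_eq0.
  by rewrite trmx_mul trmxK mulmxA -(mulmxA c) cG mul0mx.
have /freeP vfree := basis_free (vbasisP V).
rewrite basis_mxE => /vfree c0.
apply: trmx_inj; apply/matrixP => a b.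
by rewrite (ord1 b) c0 trmx0 mxE.
Qed.

Lemma orthoproj_mem V x : orthoproj V *m x \in V.
Proof.
rewrite /orthoproj -!mulmxA basis_mxE; apply: memv_suml => j _.
by apply: memvZ; apply: vbasis_mem; rewrite mem_nth ?size_tuple.
Qed.

Lemma orthoproj_orth V x v : v \in V -> v^T *m (x - orthoproj V *m x) = 0.
Proof.
move=> /coord_vbasis; set c := \col_j coord (vbasis V) j v.
have -> : \sum_(i < \dim V) coord (vbasis V) i v *: (vbasis V)`_i
    = basis_mx V *m c.
  by rewrite basis_mxE; apply: eq_bigr => j _; rewrite mxE.
move=> ->; rewrite mulmxBr trmx_mul /orthoproj !mulmxA.
rewrite -(mulmxA c^T _^T (basis_mx V)) -(mulmxA _ _ (invmx _)).
by rewrite (mulmxV (gram_unit V)) mulmx1 subrr.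
Qed.

End OrthogonalProjector.

(* The set of m-dimensional linear subspaces of R^d. The hypothesis m <= d is
   a parameter of the type because measurable types have to be inhabited. *)
Record grassmannian (R : realType) (m d : nat) (h : (m <= d)%N) := Grassmannian
  { gr_space :> {vspace 'cV[R]_d}; gr_dim : \dim gr_space == m }.
Arguments grassmannian R {m d} h.

Section Grassmannian.
Context (R : realType) (m d : nat) (h : (m <= d)%N).

HB.instance Definition _ := [isSub of grassmannian R h for @gr_space R m d h].
HB.instance Definition _ := [Choice of grassmannian R h by <:].

Lemma gr_point_dim : \dim <<take m (vbasis {: 'cV[R]_d})>> == m.
Proof.
have : free (take m (vbasis {: 'cV[R]_d})).
  apply: (@catl_free _ _ (drop m (vbasis {: 'cV[R]_d}))).
  by rewrite cat_take_drop (basis_free (vbasisP _)).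
rewrite /free => /eqP ->.
by rewrite size_takel// size_tuple dimvf /dim/= muln1.
Qed.

HB.instance Definition _ :=
  isPointed.Build (grassmannian R h) (Grassmannian h gr_point_dim).

(* The manifold topology of the Grassmannian is the one for which V |-> P_V is
   a homeomorphism onto its image in the space of d x d matrices. *)
HB.instance Definition _ := Topological.copy (grassmannian R h)
  (initial_topology (fun V : grassmannian R h => orthoproj V)).

Definition gr_borel := g_sigma_algebraType (@open (grassmannian R h)).
HB.instance Definition _ := Measurable.on gr_borel.

End Grassmannian.
Arguments gr_borel R {m d} h.

Section Haar.
Context (R : realType) (m d : nat) (h : (m <= d)%N).

Lemma rot_dim (Q : 'M[R]_d) (V : {vspace 'cV[R]_d}) :
  Q^T *m Q = 1%:M -> \dim (linfun (mulmx Q : 'cV_d -> 'cV_d) @: V) = \dim V.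
Proof.
move=> QQ; apply: limg_dim_eq.
suff /eqP -> : lker (linfun (mulmx Q : 'cV_d -> 'cV_d)) == 0%VS by exact: capv0.
apply/lker0P => x y; rewrite !lfunE/= => /(congr1 (mulmx Q^T)).
by rewrite !mulmxA QQ !mul1mx.
Qed.

Lemma gr_rot_subproof (Q : 'M[R]_d) (QQ : Q^T *m Q = 1%:M)
    (V : gr_borel R h) :
  \dim (linfun (mulmx Q : 'cV_d -> 'cV_d) @: (V : grassmannian R h)) == m.
Proof. by rewrite rot_dim// gr_dim. Qed.

(* The action V |-> Q V of the orthogonal group. *)
Definition gr_rot (Q : 'M[R]_d) (QQ : Q^T *m Q = 1%:M) (V : gr_borel R h) :
  gr_borel R h := Grassmannian h (gr_rot_subproof QQ V).

(* The normalized Haar measure is the unique Borel probability measure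
   invariant under the orthogonal group. *)
Definition is_haar (sigma : probability (gr_borel R h) R) :=
  forall (Q : 'M[R]_d) (QQ : Q^T *m Q = 1%:M) (E : set (gr_borel R h)),
    measurable E -> sigma (gr_rot QQ @^-1` E) = sigma E.

End Haar.

Definition mutually_independent (R : realType) (dO dG : measure_display)
    (O : measurableType dO) (G : measurableType dG) (P : probability O R)
    (n : nat) (V : 'I_n -> {mfun O >-> G}) :=
  forall (J : {set 'I_n}) (B : 'I_n -> set G), (forall i, measurable (B i)) ->
    P (\bigcap_(i in [set` J]) (V i @^-1` B i))
    = (\prod_(i in J) P (V i @^-1` B i))%E.

Definition hs_norm (R : realType) (p q : nat) (M : 'M[R]_(p, q)) : R :=
  Num.sqrt (\sum_i \sum_j M i j ^+ 2).

Definition sparse (R : realType) (d k : nat) (x : 'cV[R]_d) :=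
  (#|[set i | (x i 0 != 0)%R]%SET| <= k)%N.

Definition qform (R : realType) (d : nat) (A : 'M[R]_d) (x : 'cV[R]_d) : R :=
  (x^T *m A *m x) 0 0.

Definition scaled_proj (R : realType) (m d : nat) (h : (m <= d)%N)
    (V : gr_borel R h) : 'M[R]_d :=
  (d%:R / m%:R) *: orthoproj (V : grassmannian R h).

(* Main.v *)
Require Import Defs.
From HB Require Import structures.
From mathcomp Require Import all_boot all_order all_algebra.
From mathcomp Require Import all_classical all_reals all_analysis.
From mathcomp Require Import measurable_realfun measurable_fun_approximation.
From mathcomp Require Import ring lra zify.
Set Implicit Arguments.
Unset Strict Implicit.
Unset Printing Implicit Defensive.
Import Order.TTheory GRing.Theory Num.Theory.
Import numFieldNormedType.Exports.
Local Open Scope classical_set_scope.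
Local Open Scope ring_scope.

(** Write q for the minimum of m and d - m, P_i for the projector onto V_i and
    D_i = (d P_i - m) / sqrt q, which is symmetric. With a = x + y and b = x - y,

      x^T A_i x - y^T A_i y = a^T A_i b = (sqrt q / m) (<a, b> m / sqrt q + a^T D_i b),

    and the Hilbert-Schmidt norm of x x^T - y y^T is at most |a| |b|. As sqrt q is
    at least 1 and 1 - r at most 1, it suffices to bound the sum over i of
    |s + a^T D_i b| from below by a universal multiple of n, simultaneously for all
    real s and all unit vectors a, b supported on a common set of 2k coordinates;
    u_m is then a universal constant divided by m. Centring and rescaling are what
    makes every constant below independent of m and d: the entries of D_i have
    order 1 in all directions.

    Tails. The distribution of P is invariant under rotations, so in the
    expectation of a function of a^T P b, with a and b orthonormal, the pair can be
    replaced by a random one, independent of P: normalised sign vectors on the two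
    halves of the coordinates. For a fixed projector this is a decoupled chaos in
    independent signs, controlled by the off-diagonal mass of P, which is at most q
    (avg_expR_signs, haar_expR_orth). A difference of two diagonal entries of D is
    an off-diagonal entry in a rotated frame, and D has trace 0, so quadratic forms
    of D have the same exponential moments (haar_expR_vec, haar_tail).

    Small balls. The second moments of the entries of P satisfy three linear
    equations, hence D_ee - D_ff has second moment at least 1; its fourth moment is
    bounded by the tails, and a Paley-Zygmund argument keeps it away from 0
    (haar_expR_diag_diff). If e and f are the bisectors of a and b, exchanging them
    preserves the distribution of a^T D b and changes its value by D_ee - D_ff, so
    s + a^T D b is away from 0 with a universal probability, for every s
    (haar_small_ball).

    Nets. Rounding coordinates to a lattice gives nets of the sparse unit ball
    whose cardinality is exponential in k log(ed/k) (card_lnet_log), while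
    Chernoff's bound for the n independent subspaces fails with probability
    exponentially small in n (chernoff). On a net of mesh 1/4 the tails give an upper
    bound for the sum of the |x^T D_i x|, which extends to all sparse x
    (quad_bound_of_net); with it, the lower bound given by the small-ball estimate on
    a finer net extends to all a, b and s (lower_bound_of_net). *)

(** * Bilinear forms, orthonormal pairs and reflections *)

Section BilinearForms.
Context (R : realType) (d : nat).
Implicit Types (A Q : 'M[R]_d) (x y z a b e f : 'cV[R]_d) (c : R).

Definition bil A x y : R := (x^T *m A *m y) 0 0.
Definition dot x y : R := (x^T *m y) 0 0.

Lemma bilE A x y : bil A x y = \sum_i \sum_j x i 0 * A i j * y j 0.
Proof.
rewrite /bil mxE exchange_big/=; apply: eq_bigr => j _.
by rewrite mxE big_distrl/=; apply: eq_bigr => i _; rewrite mxE.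
Qed.

Lemma dotE x y : dot x y = \sum_i x i 0 * y i 0.
Proof. by rewrite /dot mxE; apply: eq_bigr => i _; rewrite mxE. Qed.

Lemma bil1 x y : bil 1%:M x y = dot x y.
Proof. by rewrite /bil mulmx1. Qed.

Lemma bilDl A x y z : bil A (x + y) z = bil A x z + bil A y z.
Proof. by rewrite /bil linearD/= !mulmxDl mxE. Qed.
Lemma bilDr A x y z : bil A x (y + z) = bil A x y + bil A x z.
Proof. by rewrite /bil mulmxDr mxE. Qed.
Lemma bilZl A c x y : bil A (c *: x) y = c * bil A x y.
Proof. by rewrite /bil linearZ/= -!scalemxAl mxE. Qed.
Lemma bilZr A c x y : bil A x (c *: y) = c * bil A x y.
Proof. by rewrite /bil -scalemxAr mxE. Qed.
Lemma bilNl A x y : bil A (- x) y = - bil A x y.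
Proof. by rewrite -scaleN1r bilZl mulN1r. Qed.
Lemma bilNr A x y : bil A x (- y) = - bil A x y.
Proof. by rewrite -scaleN1r bilZr mulN1r. Qed.
Lemma bilBl A x y z : bil A (x - y) z = bil A x z - bil A y z.
Proof. by rewrite bilDl bilNl. Qed.
Lemma bilBr A x y z : bil A x (y - z) = bil A x y - bil A x z.
Proof. by rewrite bilDr bilNr. Qed.
Lemma bil0l A x : bil A 0 x = 0.
Proof. by rewrite -(scale0r 0) bilZl mul0r. Qed.
Lemma bil0r A x : bil A x 0 = 0.
Proof. by rewrite -(scale0r 0) bilZr mul0r. Qed.

Lemma bilC A x y : A^T = A -> bil A x y = bil A y x.
Proof.
move=> AT; rewrite /bil -[LHS](mxE trmx_key (fun i j => _ j i)).
by rewrite -/(trmx _) !trmx_mul trmxK AT mulmxA.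
Qed.

Lemma bil_conj A Q x y : bil (Q *m A *m Q^T) x y = bil A (Q^T *m x) (Q^T *m y).
Proof. by rewrite /bil trmx_mul trmxK !mulmxA. Qed.

Lemma bil_delta A (i j : 'I_d) : bil A (delta_mx i 0) (delta_mx j 0) = A i j.
Proof. by rewrite /bil trmx_delta -rowE -colE !mxE. Qed.

Lemma dotC x y : dot x y = dot y x.
Proof. by rewrite -!bil1; apply: bilC; rewrite trmx1. Qed.
Lemma dotDl x y z : dot (x + y) z = dot x z + dot y z.
Proof. by rewrite -!bil1 bilDl. Qed.
Lemma dotDr x y z : dot x (y + z) = dot x y + dot x z.
Proof. by rewrite -!bil1 bilDr. Qed.
Lemma dotBl x y z : dot (x - y) z = dot x z - dot y z.
Proof. by rewrite -!bil1 bilBl. Qed.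
Lemma dotBr x y z : dot x (y - z) = dot x y - dot x z.
Proof. by rewrite -!bil1 bilBr. Qed.
Lemma dotZl c x y : dot (c *: x) y = c * dot x y.
Proof. by rewrite -!bil1 bilZl. Qed.
Lemma dotZr c x y : dot x (c *: y) = c * dot x y.
Proof. by rewrite -!bil1 bilZr. Qed.

Lemma dot_ge0 x : 0 <= dot x x.
Proof. by rewrite dotE; apply: sumr_ge0 => i _; rewrite -expr2 sqr_ge0. Qed.

Lemma dot_eq0 x : (dot x x == 0) = (x == 0).
Proof.
apply/eqP/eqP => [|->]; last by rewrite -bil1 bil0l.
move=> x0; apply: trmx_mul_eq0; apply/matrixP => i j.
by rewrite !ord1 [RHS]mxE.
Qed.

Lemma dot_gt0 x : (0 < dot x x) = (x != 0).
Proof. by rewrite lt_neqAle dot_ge0 andbT eq_sym dot_eq0. Qed.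

Lemma dot_delta (i j : 'I_d) : dot (delta_mx i 0) (delta_mx j 0) = (i == j)%:R.
Proof. by rewrite -bil1 bil_delta mxE. Qed.

Definition vnorm x : R := Num.sqrt (dot x x).

Lemma vnorm_ge0 x : 0 <= vnorm x. Proof. exact: sqrtr_ge0. Qed.
Lemma vnorm_sqr x : vnorm x ^+ 2 = dot x x.
Proof. by rewrite sqr_sqrtr// dot_ge0. Qed.
Lemma vnorm_eq0 x : (vnorm x == 0) = (x == 0).
Proof. by rewrite -sqrf_eq0 vnorm_sqr dot_eq0. Qed.
Lemma vnorm_gt0 x : (0 < vnorm x) = (x != 0).
Proof. by rewrite lt_neqAle vnorm_ge0 andbT eq_sym vnorm_eq0. Qed.

Lemma unit_vec x : x != 0 -> dot ((vnorm x)^-1 *: x) ((vnorm x)^-1 *: x) = 1.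
Proof.
move=> x0; rewrite dotZl dotZr mulrA -expr2 exprVn vnorm_sqr mulVf//.
by rewrite dot_eq0.
Qed.

Lemma unit_vecK x : x != 0 -> x = vnorm x *: ((vnorm x)^-1 *: x).
Proof. by move=> x0; rewrite scalerA mulfV ?scale1r// vnorm_eq0. Qed.

Lemma cauchy_schwarz x y : dot x y ^+ 2 <= dot x x * dot y y.
Proof.
have [->|y0] := eqVneq y 0.
  by rewrite -!bil1 !bil0r expr0n/= mulr0.
have y1 : 0 < dot y y by rewrite dot_gt0.
have := dot_ge0 (dot y y *: x - dot x y *: y).
rewrite !(dotBl, dotBr, dotZl, dotZr) (dotC y x) => H.
have : 0 <= dot y y * (dot x x * dot y y - dot x y ^+ 2).
  by apply: le_trans H _; rewrite le_eqVlt; apply/orP; left; apply/eqP; ring.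
by rewrite pmulr_rge0// subr_ge0.
Qed.

Lemma dot_le_vnorm x y : `|dot x y| <= vnorm x * vnorm y.
Proof.
rewrite -(@ler_pXn2r _ 2)// ?nnegrE ?mulr_ge0 ?vnorm_ge0//.
by rewrite exprMn !vnorm_sqr real_normK ?num_real// cauchy_schwarz.
Qed.

Lemma vnormD x y : vnorm (x + y) <= vnorm x + vnorm y.
Proof.
rewrite -(@ler_pXn2r _ 2)// ?nnegrE ?addr_ge0 ?vnorm_ge0//.
rewrite vnorm_sqr sqrrD !vnorm_sqr dotDl !dotDr (dotC y x).
have := ler_norm (dot x y); have := dot_le_vnorm x y; lra.
Qed.

(** Polarisation turns a bound on a quadratic form into one on its bilinear
    form. *)
Lemma polarization A a b : A^T = A ->
  4 * bil A a b = bil A (a + b) (a + b) - bil A (a - b) (a - b).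
Proof.
by move=> AT; rewrite !(bilDl, bilDr, bilNl, bilNr) (bilC b a AT); ring.
Qed.

(** Two vectors of equal length are exchanged by a Householder reflection,
    which fixes what is orthogonal to their difference. *)
Lemma householder x y : dot x x = dot y y ->
  exists2 Q : 'M[R]_d, Q^T *m Q = 1%:M &
    [/\ Q *m x = y, Q *m y = x & forall z, dot z (x - y) = 0 -> Q *m z = z].
Proof.
move=> xy; have [<-|xNy] := eqVneq x y.
  by exists 1%:M; rewrite ?trmx1 ?mulmx1//; split=> // *; rewrite mul1mx.
set w := x - y; have w0 : 0 < dot w w by rewrite dot_gt0 subr_eq0.
pose s := 2 / dot w w; pose Q := 1%:M - s *: (w *m w^T) : 'M[R]_d.
have QT : Q^T = Q by rewrite linearB/= linearZ/= trmx1 trmx_mul trmxK.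
have Qz z : Q *m z = z - (s * dot w z) *: w.
  rewrite mulmxBl mul1mx -scalemxAl -mulmxA (mx11_scalar (w^T *m z)).
  by rewrite -/(dot w z) mul_mx_scalar scalerA.
have sw : s * dot w w = 2 by rewrite /s divfK// gt_eqF.
have wx : 2 * dot w x = dot w w.
  by rewrite /w !(dotBl, dotBr) (dotC y x) xy; ring.
have wy : 2 * dot w y = - dot w w.
  by rewrite /w !(dotBl, dotBr) (dotC y x) xy; ring.
have swx : s * dot w x = 1.
  by apply: (@mulfI _ 2) => //; rewrite mulrCA wx sw mulr1.
have swy : s * dot w y = - 1.
  by apply: (@mulfI _ 2) => //; rewrite mulrCA wy mulrN sw mulrN1.
exists Q.
  have Qw : Q *m w = - w.
    by rewrite Qz sw scaler_nat mulr2n opprD addNKr.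
  rewrite QT {2}/Q mulmxBr mulmx1 -scalemxAr mulmxA Qw mulNmx scalerN opprK.
  by rewrite /Q subrK.
split; first by rewrite Qz swx scale1r /w opprB addrC subrK.
  by rewrite Qz swy scaleN1r opprK /w addrC subrK.
by move=> z; rewrite dotC Qz => ->; rewrite mulr0 scale0r subr0.
Qed.

Lemma dot_orth Q x y : Q^T *m Q = 1%:M -> dot (Q *m x) (Q *m y) = dot x y.
Proof. by move=> QQ; rewrite /dot trmx_mul mulmxA -(mulmxA x^T) QQ mulmx1. Qed.

Definition onpair e f := [/\ dot e e = 1, dot f f = 1 & dot e f = 0].

Lemma onpair_orth Q e f : Q^T *m Q = 1%:M -> onpair e f ->
  onpair (Q *m e) (Q *m f).
Proof. by move=> QQ [ee ff ef]; split; rewrite dot_orth. Qed.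

(** A first reflection sends [e] to [e'] and a second one, fixing [e'], corrects
    the image of [f]. *)
Lemma onpair_transitive e f e' f' : onpair e f -> onpair e' f' ->
  exists2 Q : 'M[R]_d, Q^T *m Q = 1%:M & Q *m e = e' /\ Q *m f = f'.
Proof.
move=> ef ef'; have [ee ff e0] := ef; have [ee' ff' e0'] := ef'.
have [Q1 QQ1 [Q1e _ _]] := householder (etrans ee (esym ee')).
have [_ ff1 ef1] := onpair_orth QQ1 ef.
have [Q2 QQ2 [Q2f _ Q2z]] := householder (etrans ff1 (esym ff')).
exists (Q2 *m Q1).
  by rewrite trmx_mul mulmxA -(mulmxA Q1^T) QQ2 mulmx1.
rewrite -!mulmxA Q1e Q2f; split=> //; apply: Q2z.
by rewrite dotBr -{1}Q1e ef1 e0' subrr.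
Qed.

Lemma onpair_delta (i j : 'I_d) : i != j ->
  onpair (delta_mx i 0 : 'cV[R]_d) (delta_mx j 0).
Proof. by move=> ij; split; rewrite dot_delta ?eqxx// (negbTE ij). Qed.

Lemma onpair_sym e f : onpair e f -> onpair f e.
Proof. by case=> ee ff ef; split=> //; rewrite dotC. Qed.

Definition rot45l e f := (Num.sqrt 2)^-1 *: (e + f) : 'cV[R]_d.
Definition rot45r e f := (Num.sqrt 2)^-1 *: (e - f) : 'cV[R]_d.

Let sqrt2V : (Num.sqrt 2)^-1 * (Num.sqrt 2)^-1 = 2^-1 :> R.
Proof. by rewrite -expr2 exprVn sqr_sqrtr. Qed.

Lemma onpair_rot45 e f : onpair e f -> onpair (rot45l e f) (rot45r e f).
Proof.
case=> ee ff ef; have fe : dot f e = 0 by rewrite dotC.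
split; rewrite dotZl dotZr mulrA sqrt2V !(dotBl, dotBr, dotDl, dotDr) ?(ee, ff, ef, fe);
  by field.
Qed.

Lemma bil_rot45 A e f : A^T = A ->
  bil A (rot45l e f) (rot45r e f) = (bil A e e - bil A f f) / 2.
Proof.
move=> AT; rewrite bilZl bilZr mulrA sqrt2V !(bilDl, bilBr, bilC f e AT).
by field.
Qed.

End BilinearForms.

(** * Orthogonal projectors *)

Section Projectors.
Context (R : realType) (d : nat).
Implicit Types (P : 'M[R]_d) (V : {vspace 'cV[R]_d}).

Record isproj (m : nat) P : Prop := IsProj
  { proj_tr : P^T = P; proj_idem : P *m P = P; proj_trace : \tr P = m%:R }.

Lemma orthoproj_isproj V : isproj (\dim V) (orthoproj V).
Proof.
set B := basis_mx V; set G := B^T *m B.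
have GT : G^T = G by rewrite trmx_mul trmxK.
have Gu : G \in unitmx := gram_unit V.
split; rewrite /orthoproj -/B -/G.
- by rewrite !trmx_mul trmxK trmx_inv GT mulmxA.
- by rewrite -!mulmxA (mulmxA B^T B) -/G (mulmxA (invmx G) G) mulVmx// mul1mx.
- by rewrite mxtrace_mulC mulmxA -/G mulmxV// mxtrace1.
Qed.

(** Both sides send x to the point of Q V from which x is orthogonal to Q V. *)
Lemma orthoproj_rot (Q : 'M[R]_d) V : Q^T *m Q = 1%:M ->
  orthoproj (linfun (mulmx Q : 'cV_d -> 'cV_d) @: V)%VS
  = Q *m orthoproj V *m Q^T.
Proof.
move=> QQ; set W := (_ @: V)%VS.
suff E (x : 'cV[R]_d) : orthoproj W *m x = Q *m orthoproj V *m Q^T *m x.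
  apply/matrixP => i j.
  have := congr1 (fun M : 'cV[R]_d => M i 0) (E (delta_mx j 0)).
  by rewrite -!colE !mxE.
set u := _ *m x; set v := RHS.
have uW : u \in W by exact: orthoproj_mem.
have vW : v \in W.
  rewrite /v -(mulmxA _ Q^T) -(mulmxA Q).
  have -> : Q *m (orthoproj V *m (Q^T *m x)) =
     linfun (mulmx Q : 'cV_d -> 'cV_d) (orthoproj V *m (Q^T *m x)).
    by rewrite lfunE.
  by rewrite memv_img// orthoproj_mem.
have uvW : u - v \in W by rewrite rpredB.
apply/eqP; rewrite -subr_eq0 -dot_eq0; apply/eqP.
have -> : dot (u - v) (u - v) = dot (u - v) (x - v) - dot (u - v) (x - u).
  by rewrite -dotBr; congr dot; rewrite opprB [RHS]addrC addrA subrK.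
have -> : dot (u - v) (x - u) = 0.
  by rewrite /dot orthoproj_orth// mxE.
have /memv_imgP[z zV ->] := uvW.
rewrite lfunE/= subr0 /dot trmx_mul -(mulmxA z^T).
suff -> : Q^T *m (x - v) = Q^T *m x - orthoproj V *m (Q^T *m x).
  by rewrite orthoproj_orth// mxE.
by rewrite mulmxBr /v !mulmxA QQ mul1mx.
Qed.

Section Entries.
Variables (m : nat) (P : 'M[R]_d).
Hypothesis PP : isproj m P.

Lemma projC i j : P i j = P j i.
Proof. by rewrite -[in LHS](proj_tr PP) mxE. Qed.

Lemma proj_row_sqr i : \sum_j P i j ^+ 2 = P i i.
Proof.
rewrite -[in RHS](proj_idem PP) mxE; apply: eq_bigr => j _.
by rewrite (projC j i) expr2.
Qed.

Lemma proj_diag_ge0 i : 0 <= P i i.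
Proof. by rewrite -proj_row_sqr sumr_ge0// => j _; rewrite sqr_ge0. Qed.

Lemma proj_diag_sqr_le i : P i i ^+ 2 <= P i i.
Proof.
by rewrite -[leRHS]proj_row_sqr (bigD1 i)//= lerDl sumr_ge0// => j _; rewrite sqr_ge0.
Qed.

Lemma proj_diag_le1 i : P i i <= 1.
Proof.
have := proj_diag_sqr_le i; have := proj_diag_ge0 i.
by rewrite le_eqVlt => /orP[/eqP <-//|p0]; rewrite expr2 ger_pMr.
Qed.

Lemma proj_entry_le1 i j : `|P i j| <= 1.
Proof.
rewrite -(@ler_pXn2r _ 2)// ?nnegrE// expr1n real_normK ?num_real//.
apply: le_trans (proj_diag_le1 i); rewrite -proj_row_sqr (bigD1 j)//= lerDl.
by apply: sumr_ge0 => k _; rewrite sqr_ge0.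
Qed.

Lemma proj_sum_diag : \sum_i P i i = m%:R.
Proof. by rewrite -(proj_trace PP). Qed.

(** The off-diagonal mass is the sum of P i i * (1 - P i i), which is at most
    the rank and at most the corank. *)
Lemma proj_offdiag_le : (m <= d)%N ->
  \sum_i \sum_(j | j != i) P i j ^+ 2 <= (minn m (d - m))%:R.
Proof.
move=> md.
have E i : \sum_(j | j != i) P i j ^+ 2 = P i i - P i i ^+ 2.
  by rewrite -[X in X - _]proj_row_sqr [X in X - _](bigD1 i)//= [RHS]addrC addKr.
rewrite (eq_bigr _ (fun i _ => E i)).
rewrite /minn; case: ifP => _.
  rewrite -proj_sum_diag; apply: ler_sum => i _.
  by rewrite gerBl sqr_ge0.
rewrite natrB// -proj_sum_diag -[X in X%:R - _]card_ord -sumr_const -sumrB.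
apply: ler_sum => i _; have := proj_diag_le1 i; have := sqr_ge0 (1 - P i i).
rewrite sqrrB; lra.
Qed.

End Entries.

End Projectors.

(** * Exponential inequalities *)

Section Exponential.
Context (R : realType).
Implicit Types x y t : R.

(** Invert [1 - x <= expR (- x)] and compare the geometric series with its
    second-order truncation. *)
Lemma expR_le_quadratic (x : R) : x <= 1 / 2 -> expR x <= 1 + x + 2 * x ^+ 2.
Proof.
move=> x2; have e0 := expR_gt0 x.
have h1 : (1 - x) * expR x <= 1.
  have := expR_ge1Dx (- x); rewrite -(ler_pM2r e0) -expRD addNr expR0; lra.
have h2 : 1 <= (1 - x) * (1 + x + 2 * x ^+ 2).
  have := sqr_ge0 x; set u := x ^+ 2 => u0.
  have -> : (1 - x) * (1 + x + 2 * u) = 1 + u * (1 - 2 * x).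
    by rewrite /u; ring.
  by rewrite lerDl mulr_ge0//; lra.
have : 0 < 1 - x by lra.
by move=> x0; rewrite -(ler_pM2l x0); apply: le_trans h1 h2.
Qed.

(** The optimal exponent is [x ^+ 2 / 2]; with [2 * x ^+ 2] the elementary bounds
    on the exponential are enough, near 0 and away from 0 separately. *)
Lemma cosh_le x : expR x + expR (- x) <= 2 * expR (2 * x ^+ 2).
Proof.
wlog x0 : x / 0 <= x => [H|].
  have [/H//|x0] := leP 0 x.
  by rewrite addrC -{2}(opprK x) -(sqrrN x); apply: H; lra.
have [x2|x2] := leP x (1 / 2).
  have := expR_le_quadratic x2.
  have := @expR_le_quadratic (- x) ltac:(lra).
  have := expR_ge1Dx (2 * x ^+ 2); rewrite sqrrN; lra.
have : expR x <= expR (2 * x ^+ 2).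
  rewrite ler_expR expr2 mulrA ler_peMl//; lra.
have : expR (- x) <= expR (2 * x ^+ 2).
  by rewrite ler_expR; have := sqr_ge0 x; lra.
lra.
Qed.

Lemma expRN1_le_half : expR (- 1) <= 1 / 2 :> R.
Proof.
rewrite expRN -div1r ler_pdivrMr ?expR_gt0//.
by have := @expR_ge1Dx R 1; lra.
Qed.

Lemma geometric_sum_le n : \sum_(j < n) (1 / 2) ^+ j <= 2 :> R.
Proof.
suff -> : \sum_(j < n) (1 / 2) ^+ j = 2 - 2 * (1 / 2) ^+ n :> R.
  by rewrite gerBl mulr_ge0// exprn_ge0//; lra.
elim: n => [|n IH]; first by rewrite big_ord0 expr0 mulr1 subrr.
by rewrite big_ord_recr/= IH exprS; field.
Qed.

Lemma sum_expR_sqr_le n : \sum_(j < n) expR (- j%:R ^+ 2) <= 2 :> R.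
Proof.
apply: le_trans (geometric_sum_le n); apply: ler_sum => -[j _] _ /=.
have e0 := expR_ge0 (- 1 : R); have e1 := expRN1_le_half.
apply: (@le_trans _ _ (expR (- 1) ^+ j)); last first.
  by apply: lerXn2r => //; rewrite nnegrE; lra.
rewrite -expRM_natl ler_expR mulrN1 lerN2 -natrX ler_nat.
by case: j => // j; rewrite -[X in (X <= _)%N]expn1 leq_pexp2l.
Qed.

(** Jensen's inequality for the exponential; the missing mass sits at 0. *)
Lemma jensen_expR (I : finType) (p y : I -> R) : (forall i, 0 <= p i) ->
  \sum_i p i <= 1 ->
  expR (\sum_i p i * y i) <= (1 - \sum_i p i) + \sum_i p i * expR (y i).
Proof.
move=> p0 p1; set Y := \sum_i p i * y i; set S := \sum_i p i.
have tangent u : expR Y * (1 + (u - Y)) <= expR u.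
  by rewrite -[in leRHS](subrK Y u) expRD mulrC ler_pM2r ?expR_gt0// expR_ge1Dx.
have h1 : \sum_i p i * (expR Y * (1 + (y i - Y))) <= \sum_i p i * expR (y i).
  by apply: ler_sum => i _; rewrite ler_wpM2l.
have h2 : \sum_i p i * (expR Y * (1 + (y i - Y))) = expR Y * (S + (Y - S * Y)).
  rewrite /Y /S mulr_suml -sumrB -big_split/= mulr_sumr.
  by apply: eq_bigr => i _; ring.
have := tangent 0; rewrite expR0 => t0.
have h3 : (1 - S) * (expR Y * (1 + (0 - Y))) <= 1 - S.
  by rewrite -[leRHS]mulr1 ler_wpM2l// subr_ge0.
have h4 : expR Y * (S + (Y - S * Y)) + (1 - S) * (expR Y * (1 + (0 - Y))) = expR Y.
  by ring.
rewrite -{1}h4 addrC lerD// -h2//; lra.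
Qed.

End Exponential.

(** * Random signs *)

Section RandomSigns.
Context (R : realType) (d : nat).
Implicit Types (v : 'I_d -> R) (e : {ffun 'I_d -> bool}).

Definition sgn (b : bool) : R := (-1) ^+ b.

Lemma sgn_sqr b : sgn b ^+ 2 = 1.
Proof. by case: b; rewrite /sgn ?expr1 ?expr0 ?sqrrN expr1n. Qed.

(** Expectation over independent uniform signs. *)
Definition avg (f : {ffun 'I_d -> bool} -> R) : R := (\sum_e f e) / 2 ^+ d.

Lemma avg_cst c : avg (fun=> c) = c.
Proof.
by rewrite /avg sumr_const card_ffun card_bool card_ord -[X in X / _]mulr_natr natrX mulfK.
Qed.

Lemma le_avg f g : (forall e, f e <= g e) -> avg f <= avg g.
Proof.
by move=> fg; rewrite /avg ler_wpM2r ?invr_ge0 ?exprn_ge0// ler_sum.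
Qed.

Lemma avg_sum (I : finType) (f : I -> {ffun 'I_d -> bool} -> R) :
  avg (fun e => \sum_i f i e) = \sum_i avg (f i).
Proof. by rewrite /avg exchange_big/= mulr_suml. Qed.

Lemma avgD f g : avg (fun e => f e + g e) = avg f + avg g.
Proof. by rewrite /avg big_split/= mulrDl. Qed.

Lemma avgZ c f : avg (fun e => c * f e) = c * avg f.
Proof. by rewrite /avg -mulr_sumr mulrA. Qed.

Definition rad v e : R := \sum_i v i * sgn (e i).

(** Sign sums are sub-Gaussian: the exponential factorises over the coordinates. *)
Lemma avg_expR_rad v : avg (fun e => expR (rad v e)) <= expR (2 * \sum_i v i ^+ 2).
Proof.
have -> : avg (fun e => expR (rad v e)) =
    \prod_i ((expR (v i) + expR (- v i)) / 2).
  rewrite big_split/= prodr_const card_ord exprVn /avg; congr (_ * _).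
  have -> : \prod_i (expR (v i) + expR (- v i)) =
      \prod_i \sum_(b : bool) expR (v i * sgn b).
    apply: eq_bigr => i _.
    by rewrite big_bool /sgn/= expr1 expr0 mulr1 mulrN1 addrC.
  rewrite bigA_distr_bigA/=; apply: eq_bigr => e _.
  by rewrite /rad expR_sum.
rewrite mulr_sumr expR_sum; apply: ler_prod => i _; apply/andP; split.
  by rewrite divr_ge0// addr_ge0// expR_ge0.
by rewrite ler_pdivrMr// [leRHS]mulrC cosh_le.
Qed.

Lemma radN v e : rad (fun i => - v i) e = - rad v e.
Proof. by rewrite /rad -sumrN; apply: eq_bigr => i _; rewrite mulNr. Qed.

Lemma radZ c v e : rad (fun i => c * v i) e = c * rad v e.
Proof. by rewrite /rad mulr_sumr; apply: eq_bigr => i _; rewrite mulrA. Qed.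

(** The exponent [s ^+ 2 / 12] is the maximum over real [j] of
    [j * s - 3 * j ^+ 2], and rounding the maximiser down to an integer costs at
    most 3. *)
Lemma expR_sqr_le_sum (s : R) n : `|s| / 6 < n%:R ->
  expR (s ^+ 2 / 12) <= expR 3 *
    \sum_(j < n) expR (- (3 * j%:R ^+ 2)) * (expR (j%:R * s) + expR (- (j%:R * s))).
Proof.
move=> sn; set j := Num.truncn (`|s| / 6).
have /andP[j1 j2] := Num.Theory.truncn_itv (divr_ge0 (normr_ge0 s) (ler0n R 6)).
rewrite -/j in j1 j2.
have jn : (j < n)%N by rewrite -(ltr_nat R); apply: le_lt_trans sn.
have hj : s ^+ 2 / 12 <= 3 + (- (3 * j%:R ^+ 2) + j%:R * `|s|).
  rewrite -(real_normK (num_real s)); move: j1 j2.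
  have -> : j.+1%:R = j%:R + 1 :> R by rewrite natr1.
  set a : R := `|s|; set b : R := j%:R => j1 j2.
  have -> : a ^+ 2 / 12 = 3 * (a / 6 - b) ^+ 2 + (- (3 * b ^+ 2) + b * a) by field.
  rewrite lerD2r -[leRHS]mulr1 ler_pM2l// -[leRHS](expr1n _ 2).
  by apply: lerXn2r; rewrite ?nnegrE; lra.
apply: (@le_trans _ _ (expR (3 + (- (3 * j%:R ^+ 2) + j%:R * `|s|)))).
  by rewrite ler_expR.
rewrite !expRD ler_pM2l ?expR_gt0//.
rewrite (bigD1 (Ordinal jn))//= -[leLHS]addr0; apply: lerD; last first.
  by apply: sumr_ge0 => i _; rewrite mulr_ge0 ?expR_ge0 ?addr_ge0 ?expR_ge0.
rewrite ler_pM2l ?expR_gt0//.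
have [s0|s0] := leP 0 s; first by rewrite ger0_norm// lerDl expR_ge0.
by rewrite ltr0_norm// mulrN lerDr expR_ge0.
Qed.

(** Square-exponential moments follow from the sub-Gaussian bound at the integer
    parameters [j], since the sum of [expR (2 * j ^+ 2 - 3 * j ^+ 2)] converges. *)
Lemma avg_expR_rad_sqr v : \sum_i v i ^+ 2 <= 1 ->
  avg (fun e => expR (rad v e ^+ 2 / 12)) <= 4 * expR 3.
Proof.
move=> v1.
pose n := (Num.truncn (\sum_i `|v i|)).+1.
have rn e : `|rad v e| / 6 < n%:R.
  have h : `|rad v e| <= \sum_i `|v i|.
    apply: le_trans (ler_norm_sum _ _ _) _; apply: ler_sum => i _.
    by rewrite normrM /sgn normrX normrN1 expr1n mulr1.
  have := Num.Theory.truncnS_gt (\sum_i `|v i|); rewrite -/n.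
  have := normr_ge0 (rad v e); lra.
apply: le_trans (le_avg (fun e => expR_sqr_le_sum (rn e))) _.
rewrite avgZ mulrC ler_pM2r ?expR_gt0// avg_sum.
apply: (@le_trans _ _ (\sum_(j < n) 2 * expR (- j%:R ^+ 2))); last first.
  by rewrite -mulr_sumr; have := @sum_expR_sqr_le R n; lra.
apply: ler_sum => j _; rewrite avgZ avgD.
have b1 : avg (fun e => expR (j%:R * rad v e)) <= expR (2 * j%:R ^+ 2).
  under eq_fun do rewrite -radZ.
  apply: le_trans (avg_expR_rad _) _; rewrite ler_expR ler_pM2l//.
  under eq_bigr do rewrite exprMn.
  by rewrite -mulr_sumr ler_piMr// exprn_ge0.
have b2 : avg (fun e => expR (- (j%:R * rad v e))) <= expR (2 * j%:R ^+ 2).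
  under eq_fun do rewrite -radZ -radN.
  apply: le_trans (avg_expR_rad _) _; rewrite ler_expR ler_pM2l//.
  under eq_bigr do rewrite sqrrN exprMn.
  by rewrite -mulr_sumr ler_piMr// exprn_ge0.
apply: (@le_trans _ _ (expR (- (3 * j%:R ^+ 2)) * (2 * expR (2 * j%:R ^+ 2)))).
  by rewrite ler_pM2l ?expR_gt0//; lra.
by rewrite mulrCA -expRD ler_pM2l// ler_expR; lra.
Qed.

End RandomSigns.

(** * Projectors at orthonormal pairs of random sign vectors *)

Section SplitSigns.
Context (R : realType) (d : nat) (d2 : (1 < d)%N).
Implicit Types (e : {ffun 'I_d -> bool}) (P : 'M[R]_d).

Let l := d./2.

Let l_gt0 : (0 < l)%N. Proof. by rewrite /l half_gt0. Qed.
Let l_lt : (l < d)%N.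
Proof. by rewrite /l ltn_half_double -addnn -[X in (X < _)%N]add0n ltn_add2r (ltn_trans _ d2). Qed.
Let l' := (d - l)%N.
Let l'_gt0 : (0 < l')%N. Proof. by rewrite subn_gt0. Qed.

Let ll' : d%:R ^+ 2 <= 9 * (l%:R * l'%:R) :> R.
Proof.
rewrite -natrX -!natrM ler_nat /l'.
have := odd_double_half d; rewrite -/l => E.
have -> : (d - l = odd d + l)%N by rewrite -{1}E -addnn addnA addnK.
rewrite -{1}E -addnn; move: l_gt0; case: l => // k _.
case: (odd d) => /=; rewrite ?add1n ?add0n expnS expn1; nia.
Qed.

(** Sign vectors supported on the two halves of the coordinates, normalised to
    length 1: any choice of signs gives an orthonormal pair. *)
Definition lsigns e : 'cV[R]_d :=
  \col_i (if (i < l)%N then sgn R (e i) / Num.sqrt l%:R else 0).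
Definition rsigns e : 'cV[R]_d :=
  \col_i (if (i < l)%N then 0 else sgn R (e i) / Num.sqrt l'%:R).

Lemma onpair_signs e e' : onpair (lsigns e) (rsigns e').
Proof.
have E (b : bool) (k : nat) : sgn R b / Num.sqrt k%:R * (sgn R b / Num.sqrt k%:R) = k%:R^-1.
  by rewrite -expr2 exprMn sgn_sqr mul1r exprVn sqr_sqrtr.
split; rewrite dotE.
- under eq_bigr do rewrite mxE.
  rewrite (bigID (fun i : 'I_d => (i < l)%N))/= [X in _ + X]big1 ?addr0; last first.
    by move=> i /negbTE ->; rewrite mul0r.
  rewrite (eq_bigr (fun=> l%:R^-1)); last by move=> i ->; rewrite E.
  rewrite sumr_const.
  have -> : #|[pred i : 'I_d | (i < l)%N]| = l.
    by rewrite -sum1_card big_ord_narrow ?(ltnW l_lt)// sum1_card card_ord.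
  by rewrite -[LHS]mulr_natr mulVf// pnatr_eq0 -lt0n.
- under eq_bigr do rewrite mxE.
  rewrite (bigID (fun i : 'I_d => (i < l)%N))/= [X in X + _]big1 ?add0r; last first.
    by move=> i ->; rewrite mul0r.
  rewrite (eq_bigr (fun=> l'%:R^-1)); last by move=> i /negbTE ->; rewrite E.
  rewrite sumr_const.
  have -> : #|[pred i : 'I_d | ~~ (i < l)%N]| = l'.
    have := cardC [pred i : 'I_d | (i < l)%N]; rewrite card_ord.
    have -> : #|[pred i : 'I_d | (i < l)%N]| = l.
      by rewrite -sum1_card big_ord_narrow ?(ltnW l_lt)// sum1_card card_ord.
    move=> E'; apply/eqP; rewrite -(eqn_add2l l) subnKC ?(ltnW l_lt)//.
    apply/eqP; rewrite -[RHS]E'; congr addn; apply: eq_card => i; rewrite !inE.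
  by rewrite -[LHS]mulr_natr mulVf// pnatr_eq0 -lt0n.
- apply: big1 => i _; rewrite !mxE.
  by case: ifP; rewrite ?mulr0 ?mul0r.
Qed.

(** Independent signs on the two halves of the coordinates make [P] a decoupled
    chaos: conditionally on the right half it is a sign sum whose variance is a
    quadratic form of total mass at most the off-diagonal mass of [P], and
    Jensen's inequality reduces that form to squares of sign sums. *)
Lemma avg_expR_signs (m : nat) P (t : R) : isproj m P -> (0 < m < d)%N ->
  t ^+ 2 <= 1 / 216 ->
  avg (fun e => avg (fun e' => expR (t * (d%:R / Num.sqrt (minn m (d - m))%:R
     * bil P (lsigns e') (rsigns e))))) <= 4 * expR 3.
Proof.
move=> PP /andP[m0 md] t216; set q := minn m (d - m).
have q0 : 0 < q%:R :> R by rewrite ltr0n leq_min m0 subn_gt0.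
(* [w] is the off-diagonal block of [P] and [N i] the squared norm of its row
   [i]; dividing by [Num.sqrt (N i)] is harmless for a zero row. *)
pose w (i j : 'I_d) := if (i < l)%N && ~~ (j < l)%N then P i j else 0.
pose N i := \sum_j w i j ^+ 2.
have N0 i : 0 <= N i by rewrite sumr_ge0// => j _; rewrite sqr_ge0.
pose wn i j := w i j / Num.sqrt (N i).
have wE i j : w i j = Num.sqrt (N i) * wn i j.
  have [Ni|Ni] := eqVneq (N i) 0.
    rewrite Ni sqrtr0 mul0r; apply/eqP.
    move/eqP: Ni; rewrite psumr_eq0 => [/allP/(_ j)|k _]; last exact: sqr_ge0.
    by rewrite mem_index_enum => /(_ isT); rewrite sqrf_eq0.
  by rewrite mulrC divfK// sqrtr_eq0 -ltNge lt_neqAle eq_sym Ni N0.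
have wn1 i : \sum_j wn i j ^+ 2 <= 1.
  under eq_bigr do rewrite exprMn exprVn sqr_sqrtr//.
  rewrite -mulr_suml -/(N i).
  by have [->|Ni] := eqVneq (N i) 0; rewrite ?mul0r// divff.
have sumN : \sum_i N i <= q%:R.
  apply: le_trans (proj_offdiag_le PP (ltnW md)); apply: ler_sum => i _.
  rewrite [leRHS]big_mkcond; apply: ler_sum => j _; rewrite /w.
  have [->|ji] := eqVneq j i; first by rewrite andbN expr0n.
  by case: ifP => //; rewrite expr0n sqr_ge0.
pose s := t * (d%:R / Num.sqrt q%:R / (Num.sqrt l%:R * Num.sqrt l'%:R)).
have s2 : 2 * s ^+ 2 <= (12 * q%:R)^-1.
  have lr0 : 0 < l%:R * l'%:R :> R by rewrite mulr_gt0// ltr0n.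
  have -> : s ^+ 2 = t ^+ 2 * (d%:R ^+ 2 / (l%:R * l'%:R)) / q%:R.
    rewrite /s !(exprMn, exprVn) !sqr_sqrtr//; field.
    by rewrite !gt_eqF// ltr0n.
  rewrite (invfM 12) (mulrA 2) ler_pM2r ?invr_gt0//.
  have : t ^+ 2 * (d%:R ^+ 2 / (l%:R * l'%:R)) <= 1 / 216 * 9.
    apply: ler_pM => //; rewrite ?sqr_ge0// ?divr_ge0 ?sqr_ge0 ?(ltW lr0)//.
    by rewrite ler_pdivrMr.
  lra.
pose p i := N i / q%:R.
pose y e i := rad (wn i) e ^+ 2 / 12.
have p0 i : 0 <= p i by rewrite divr_ge0// ltW.
have p1 : \sum_i p i <= 1 by rewrite -mulr_suml ler_pdivrMr// mul1r.
have step e : avg (fun e' => expR (t * (d%:R / Num.sqrt q%:R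
     * bil P (lsigns e') (rsigns e)))) <= (1 - \sum_i p i) + \sum_i p i * expR (y e i).
  apply: le_trans (jensen_expR _ p0 p1).
  under eq_fun => e'.
    rewrite (_ : t * _ = rad (fun i => s * rad (w i) e) e'); first over.
    rewrite bilE /rad /s !mulr_sumr; apply: eq_bigr => i _.
    rewrite !mulr_sumr mulr_suml; apply: eq_bigr => j _.
    rewrite /lsigns /rsigns !mxE /w.
    case: (ltnP i l) => il; case: (ltnP j l) => jl /=;
      rewrite ?(mulr0, mul0r)//.
    rewrite (invfM (Num.sqrt l%:R)); ring.
  apply: le_trans (avg_expR_rad _) _; rewrite ler_expR.
  rewrite mulr_sumr; apply: ler_sum => i _.
  have -> : p i * y e i = (12 * q%:R)^-1 * rad (w i) e ^+ 2.
    rewrite (_ : rad (w i) e = Num.sqrt (N i) * rad (wn i) e); last first.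
      by rewrite -radZ; congr rad; apply/funext => j; rewrite wE.
    by rewrite exprMn sqr_sqrtr// /p /y; field; rewrite gt_eqF.
  by rewrite exprMn mulrA ler_wpM2r// sqr_ge0.
apply: le_trans (le_avg step) _; rewrite avgD avg_cst avg_sum.
have h : \sum_i avg (fun e => p i * expR (y e i)) <= \sum_i p i * (4 * expR 3).
  apply: ler_sum => i _; rewrite avgZ ler_wpM2l//.
  exact: avg_expR_rad_sqr.
rewrite -mulr_suml in h; set S := \sum_i p i in p1 h *.
have : (1 - S) * 1 <= (1 - S) * (4 * expR 3).
  rewrite ler_wpM2l ?subr_ge0//; have := @expR_ge1Dx R 3; lra.
lra.
Qed.

End SplitSigns.

(** * Expectations of bounded measurable functions *)

Section BoundedMeasurable.
Context (disp : measure_display) (T : measurableType disp) (R : realType).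
Implicit Types (f g : T -> R) (mu : probability T R).

Definition bdmeas f := measurable_fun setT f /\ exists M : R, forall x, `|f x| <= M.

Lemma bdmeas_cst (c : R) : bdmeas (fun=> c).
Proof. by split; [exact: measurable_cst|exists `|c|]. Qed.

Lemma bdmeasD f g : bdmeas f -> bdmeas g -> bdmeas (fun x => f x + g x).
Proof.
move=> [mf [M fM]] [mg [N gN]]; split; first exact: measurable_funD.
by exists (M + N) => x; apply: le_trans (ler_normD _ _) _; exact: lerD.
Qed.

Lemma bdmeasM f g : bdmeas f -> bdmeas g -> bdmeas (fun x => f x * g x).
Proof.
move=> [mf [M fM]] [mg [N gN]]; split; first exact: measurable_funM.
by exists (M * N) => x; rewrite normrM ler_pM.
Qed.

Lemma bdmeasZ c f : bdmeas f -> bdmeas (fun x => c * f x).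
Proof. by move=> bf; apply: bdmeasM => //; exact: bdmeas_cst. Qed.

Lemma bdmeasN f : bdmeas f -> bdmeas (fun x => - f x).
Proof.
by move=> /(bdmeasZ (-1)); under eq_fun do rewrite mulN1r.
Qed.

Lemma bdmeasB f g : bdmeas f -> bdmeas g -> bdmeas (fun x => f x - g x).
Proof. by move=> bf /bdmeasN; exact: bdmeasD. Qed.

Lemma bdmeasX f n : bdmeas f -> bdmeas (fun x => f x ^+ n).
Proof.
move=> [mf [M fM]]; split; first exact: measurable_funX.
by exists (M ^+ n) => x; rewrite normrX lerXn2r ?nnegrE// (le_trans _ (fM x)).
Qed.

Lemma bdmeas_norm f : bdmeas f -> bdmeas (fun x => `|f x|).
Proof.
move=> [mf [M fM]]; split; first exact: measurableT_comp.
by exists M => x; rewrite normr_id.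
Qed.

Lemma bdmeas_expR f : bdmeas f -> bdmeas (fun x => expR (f x)).
Proof.
move=> [mf [M fM]]; split; first exact: measurableT_comp.
exists (expR M) => x; rewrite ger0_norm ?expR_ge0// ler_expR.
exact: le_trans (ler_norm _) (fM x).
Qed.

Lemma bdmeas_sum (I : Type) (s : seq I) (f : I -> T -> R) :
  (forall i, bdmeas (f i)) -> bdmeas (fun x => \sum_(i <- s) f i x).
Proof.
move=> bf; elim: s => [|i s IH].
  by under eq_fun do rewrite big_nil; exact: bdmeas_cst.
by under eq_fun do rewrite big_cons; exact: bdmeasD.
Qed.

Lemma bdmeas_indic (A : set T) : measurable A -> bdmeas (\1_A : T -> R).
Proof.
move=> mA; split; first exact: measurable_indic.
by exists 1 => x; rewrite indicE ger0_norm//; case: (_ \in _).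
Qed.

Variable mu : probability T R.

Lemma bdmeas_integrable f : bdmeas f -> mu.-integrable setT (EFin \o f).
Proof.
move=> [mf [M fM]]; apply: measurable_bounded_integrable => //.
  exact: le_lt_trans (probability_le1 mu measurableT) (ltry _).
exists M; split; first exact: num_real.
by move=> K MK x _; exact: le_trans (fM x) (ltW MK).
Qed.

Lemma ExD f g : bdmeas f -> bdmeas g ->
  \int[mu]_x (f x + g x) = \int[mu]_x f x + \int[mu]_x g x.
Proof. by move=> /bdmeas_integrable ? /bdmeas_integrable ?; exact: RintegralD. Qed.

Lemma ExB f g : bdmeas f -> bdmeas g ->
  \int[mu]_x (f x - g x) = \int[mu]_x f x - \int[mu]_x g x.
Proof. by move=> /bdmeas_integrable ? /bdmeas_integrable ?; exact: RintegralB. Qed.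

Lemma ExZ c f : bdmeas f -> \int[mu]_x (c * f x) = c * \int[mu]_x f x.
Proof. by move=> /bdmeas_integrable ?; exact: RintegralZl. Qed.

Lemma Ex_cst (c : R) : \int[mu]_(_ in setT) c = c.
Proof.
rewrite Rintegral_cst//.
by rewrite (_ : fine _ = 1) ?mulr1//; exact: (congr1 fine (probability_setT mu)).
Qed.

Lemma le_Ex f g : bdmeas f -> bdmeas g -> (forall x, f x <= g x) ->
  \int[mu]_x f x <= \int[mu]_x g x.
Proof. by move=> /bdmeas_integrable ? /bdmeas_integrable ? ?; exact: le_Rintegral. Qed.

Lemma Ex_sum (I : Type) (s : seq I) (f : I -> T -> R) : (forall i, bdmeas (f i)) ->
  \int[mu]_x (\sum_(i <- s) f i x) = \sum_(i <- s) \int[mu]_x f i x.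
Proof.
move=> bf; elim: s => [|i s IH].
  by under eq_Rintegral do rewrite big_nil; rewrite Ex_cst big_nil.
under eq_Rintegral do rewrite big_cons.
by rewrite ExD ?IH ?big_cons//; exact: bdmeas_sum.
Qed.

Lemma Ex_indic (A : set T) : measurable A -> \int[mu]_x \1_A x = fine (mu A).
Proof. by move=> mA; rewrite /Rintegral integral_indic// setIT. Qed.

(** Chernoff's form of Markov's inequality. *)
Lemma expR_markov f : bdmeas f ->
  fine (mu [set x | 0 <= f x]) <= \int[mu]_x expR (f x).
Proof.
move=> bf; have mA : measurable [set x | 0 <= f x].
  by rewrite -[X in measurable X]setTI; exact: measurable_fun_le (measurable_cst _) bf.1.
rewrite -Ex_indic//; apply: le_Ex; [exact: bdmeas_indic|exact: bdmeas_expR|].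
move=> x; rewrite indicE; case: (boolP (_ \in _)) => [|_]; last exact: expR_ge0.
by rewrite inE /= => f0; rewrite -(expR0 R) ler_expR.
Qed.

End BoundedMeasurable.

Section Transfer.
Context (d1 d2 : measure_display) (X : measurableType d1) (Y : measurableType d2).
Context (R : realType) (mu : probability X R) (nu : probability Y R).

Lemma Ex_transfer (phi : X -> Y) (f : Y -> R) : measurable_fun setT phi ->
  (forall B, measurable B -> mu (phi @^-1` B) = nu B) -> bdmeas f ->
  \int[mu]_x f (phi x) = \int[nu]_y f y.
Proof.
move=> mphi munu bf; rewrite /Rintegral; congr fine.
rewrite -[LHS](@integral_pushforward _ _ _ _ _ _ mphi mu setT (EFin \o f))//.
- by apply: eq_measure_integral => B mB _; exact: munu.
- by apply/measurable_EFinP; case: bf.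
- rewrite preimage_setT; apply: (@bdmeas_integrable _ _ _ mu (f \o phi)).
  case: bf => mf [M fM]; split; first exact: measurableT_comp.
  by exists M => x /=.
Qed.

End Transfer.

(** * Measurability on the Grassmannian *)

Lemma cvg_sumr (R : realType) (T I : Type) (F : set_system T) (FF : Filter F)
    (s : seq I) (f : I -> T -> R) (l : I -> R) :
  (forall i, f i x @[x --> F] --> l i) ->
  \sum_(i <- s) f i x @[x --> F] --> \sum_(i <- s) l i.
Proof.
by move=> fl; apply: cvg_big => // -[x y]; exact: pseudometric_normed_Zmodule.add_continuous.
Qed.

Lemma cvg_conj (R : realType) (d : nat) (Q M : 'M[R]_d)
    (F : set_system 'M[R]_d) (FF : Filter F) i j :
  (forall a b, N a b @[N --> F] --> M a b) ->
  (Q *m N *m Q^T) i j @[N --> F] --> (Q *m M *m Q^T) i j.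
Proof.
move=> FM; under eq_fun do rewrite mxE; rewrite mxE.
apply: cvg_sumr => a; apply: cvgM; last exact: cvg_cst.
under eq_fun do rewrite mxE; rewrite mxE.
by apply: cvg_sumr => b; apply: cvgM; [exact: cvg_cst|exact: FM].
Qed.

Section GrassmannianMeasurability.
Context (R : realType) (m d : nat) (h : (m <= d)%N).
Local Notation gr := (gr_borel R h).

Definition pr (V : gr) : 'M[R]_d := orthoproj (V : grassmannian R h).

Lemma pr_isproj V : isproj m (pr V).
Proof. by have := orthoproj_isproj (V : grassmannian R h); rewrite (eqP (gr_dim _)). Qed.

Lemma pr_rot (Q : 'M[R]_d) (QQ : Q^T *m Q = 1%:M) V :
  pr (gr_rot QQ V) = Q *m pr V *m Q^T.
Proof. exact: orthoproj_rot. Qed.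

Lemma gr_open_preimage (U : set 'M[R]_d) : open U ->
  measurable (pr @^-1` U : set gr).
Proof. by move=> oU; apply: sub_sigma_algebra; exists U. Qed.

Lemma bdmeas_entry (i j : 'I_d) : bdmeas (fun V : gr => pr V i j).
Proof.
split; last by exists 1 => V; exact: proj_entry_le1 (pr_isproj V) i j.
apply: (measurability _ (RGenOpens.measurableE R)).
move=> _ [_ [a [b ->] <-]]; rewrite setTI.
apply: (@gr_open_preimage ((fun M : 'M[R]_d => M i j) @^-1` `]a, b[)).
by apply: open_comp => [M _|]; [exact: coord_continuous|exact: interval_open].
Qed.

Lemma bdmeas_bil (a b : 'cV[R]_d) : bdmeas (fun V : gr => bil (pr V) a b).
Proof.
under eq_fun do rewrite bilE.
apply: bdmeas_sum => i; apply: bdmeas_sum => j.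
under eq_fun do rewrite mulrAC.
by apply: bdmeasZ; exact: bdmeas_entry.
Qed.

Lemma conj_continuous (Q : 'M[R]_d) :
  continuous (fun M : 'M[R]_d => Q *m M *m Q^T).
Proof.
move=> M A [P PM PA].
have H : \forall N \near M, forall i j, P i j ((Q *m N *m Q^T) i j).
  apply: (@filter_forall _ _ (fun i N => forall j, P i j ((Q *m N *m Q^T) i j))
    _ (nbhs_filter M)) => i.
  apply: (@filter_forall _ _ (fun j N => P i j ((Q *m N *m Q^T) i j)) _ (nbhs_filter M)) => j.
  have ce := @cvg_conj _ _ Q M _ (nbhs_filter M) i j
    (fun a b => @coord_continuous _ _ _ a b M).
  exact: ce (PM i j).
by apply: filterS H => N NP; apply: PA.
Qed.

Lemma measurable_gr_rot (Q : 'M[R]_d) (QQ : Q^T *m Q = 1%:M) :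
  measurable_fun setT (gr_rot QQ : gr -> gr).
Proof.
apply: (@measurability _ _ _ _ setT (gr_rot QQ : gr -> gr) (@open (grassmannian R h))) => //.
move=> _ [_ [U oU <-] <-]; rewrite setTI.
rewrite (_ : _ @^-1` _ = pr @^-1` ((fun M => Q *m M *m Q^T) @^-1` U)).
  apply: gr_open_preimage; apply: open_comp oU => M _; exact: conj_continuous.
by apply/seteqP; split=> V /=; rewrite -(pr_rot QQ).
Qed.

End GrassmannianMeasurability.

(** * Moments of a Haar-distributed projector *)

Section HaarMoments.
Context (R : realType) (m d : nat) (hm : (0 < m)%N) (hmd : (m < d)%N).
Local Notation gr := (gr_borel R (ltnW hmd)).
Context (sigma : probability gr R) (hsigma : is_haar sigma).
Implicit Types (a b f x y : 'cV[R]_d).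

Let d2 : (1 < d)%N. Proof. exact: leq_ltn_trans hmd. Qed.
Let d0 : (0 < d)%N. Proof. exact: ltnW. Qed.
Let i0 : 'I_d := Ordinal d0.
Let i1 : 'I_d := Ordinal d2.
Let q := minn m (d - m).
Let q0 : 0 < q%:R :> R. Proof. by rewrite ltr0n leq_min hm subn_gt0. Qed.
Let rq0 : 0 < Num.sqrt q%:R :> R. Proof. by rewrite sqrtr_gt0. Qed.
Let dR0 : 0 < d%:R :> R. Proof. by rewrite ltr0n. Qed.

Lemma haar_rot (Q : 'M[R]_d) (g : 'M[R]_d -> R) : Q^T *m Q = 1%:M ->
  bdmeas (fun V : gr => g (pr V)) ->
  \int[sigma]_V g (Q *m pr V *m Q^T) = \int[sigma]_V g (pr V).
Proof.
move=> QQ bg; under eq_Rintegral do rewrite -(pr_rot QQ).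
apply: (@Ex_transfer _ _ gr gr R sigma sigma (gr_rot QQ) (fun V => g (pr V))) => //.
  exact: measurable_gr_rot.
by move=> B mB; exact: hsigma.
Qed.

Lemma haar_vec (F : R -> R) x y : dot x x = dot y y ->
  bdmeas (fun V : gr => F (bil (pr V) y y)) ->
  \int[sigma]_V F (bil (pr V) x x) = \int[sigma]_V F (bil (pr V) y y).
Proof.
move=> xy bF; have [Q QQ [Qx _ _]] := householder xy.
rewrite -(haar_rot (g := fun M => F (bil M y y)) QQ)//; apply: eq_Rintegral => V _.
by rewrite bil_conj -Qx mulmxA QQ mul1mx.
Qed.

(** The orthogonal group is transitive on orthonormal pairs, so the law of the
    compression of the projector to a plane does not depend on the plane. *)
Lemma haar_onpair (F : R -> R -> R -> R) e f e' f' :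
  onpair e f -> onpair e' f' ->
  bdmeas (fun V : gr => F (bil (pr V) e' e') (bil (pr V) e' f') (bil (pr V) f' f')) ->
  \int[sigma]_V F (bil (pr V) e e) (bil (pr V) e f) (bil (pr V) f f)
  = \int[sigma]_V F (bil (pr V) e' e') (bil (pr V) e' f') (bil (pr V) f' f').
Proof.
move=> ef ef' bF; have [Q QQ [Qe Qf]] := onpair_transitive ef ef'.
rewrite -(haar_rot (g := fun M => F (bil M e' e') (bil M e' f') (bil M f' f')) QQ)//.
apply: eq_Rintegral => V _.
by rewrite !bil_conj -Qe -Qf !mulmxA QQ !mul1mx.
Qed.

Lemma Ex_avg (g : {ffun 'I_d -> bool} -> gr -> R) : (forall e, bdmeas (g e)) ->
  \int[sigma]_V avg (fun e => g e V) = avg (fun e => \int[sigma]_V g e V).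
Proof.
move=> bg; rewrite /avg; under eq_Rintegral do rewrite mulrC.
by rewrite ExZ ?Ex_sum 1?mulrC//; exact: bdmeas_sum.
Qed.

(** By invariance the expectation is unchanged when [a] and [b] are averaged over
    the sign vectors of the two halves, and for each fixed projector that average
    is bounded. *)
Lemma haar_expR_orth a b (t : R) : onpair a b -> t ^+ 2 <= 1 / 216 ->
  \int[sigma]_V expR (t * (d%:R / Num.sqrt q%:R * bil (pr V) a b)) <= 4 * expR 3.
Proof.
move=> ab t2.
have bE x y : bdmeas (fun V : gr => expR (t * (d%:R / Num.sqrt q%:R * bil (pr V) x y))).
  by apply: bdmeas_expR; do 2 apply: bdmeasZ; exact: bdmeas_bil.
have bA (e : {ffun 'I_d -> bool}) : bdmeas (fun V : gr => avg (fun e' =>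
    expR (t * (d%:R / Num.sqrt q%:R * bil (pr V) (lsigns R e') (rsigns R e))))).
  by rewrite /avg; under eq_fun do rewrite mulrC; apply: bdmeasZ; exact: bdmeas_sum.
have E (e e' : {ffun 'I_d -> bool}) :
  \int[sigma]_V expR (t * (d%:R / Num.sqrt q%:R * bil (pr V) (lsigns R e') (rsigns R e)))
  = \int[sigma]_V expR (t * (d%:R / Num.sqrt q%:R * bil (pr V) a b)).
  apply: (haar_onpair (F := fun _ v _ => expR (t * (d%:R / Num.sqrt q%:R * v)))) => //.
  exact: onpair_signs.
rewrite -[leLHS](avg_cst d) (_ : (fun=> _) = (fun e => \int[sigma]_V avg (fun e' =>
    expR (t * (d%:R / Num.sqrt q%:R * bil (pr V) (lsigns R e') (rsigns R e)))))); last first.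
  apply/funext => e; rewrite Ex_avg// -[LHS](avg_cst d); congr avg.
  by apply/funext => e'; rewrite E.
rewrite -Ex_avg// -[leRHS](Ex_cst sigma); apply: le_Ex.
- by rewrite /avg; under eq_fun do rewrite mulrC; apply: bdmeasZ; exact: bdmeas_sum.
- exact: bdmeas_cst.
- move=> V; apply: avg_expR_signs (pr_isproj V) _ t2 => //.
  by rewrite hm.
Qed.

(** [pr V] recentred at its mean and rescaled: its bilinear form has entries of
    order 1 whatever [m] and [d] are. *)
Definition Dmat (V : gr) : 'M[R]_d :=
  (Num.sqrt q%:R)^-1 *: (d%:R *: pr V - m%:R%:M).

Lemma bil_Dmat V a b :
  bil (Dmat V) a b = (d%:R * bil (pr V) a b - m%:R * dot a b) / Num.sqrt q%:R.
Proof.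
rewrite /bil /dot /Dmat -!scalemxAr -!scalemxAl mulmxBr mulmxBl.
by rewrite -scalemxAr -scalemxAl mul_mx_scalar -scalemxAl !mxE mulrC.
Qed.

Lemma Dmat_tr V : (Dmat V)^T = Dmat V.
Proof.
by rewrite /Dmat linearZ linearB linearZ/= (proj_tr (pr_isproj V)) tr_scalar_mx.
Qed.

Lemma bdmeas_Dmat a b : bdmeas (fun V : gr => bil (Dmat V) a b).
Proof.
under eq_fun do rewrite bil_Dmat mulrC.
apply: bdmeasZ; apply: bdmeasB; last exact: bdmeas_cst.
by apply: bdmeasZ; exact: bdmeas_bil.
Qed.

Let i01 : i0 != i1. Proof. by []. Qed.

(** The trace of [Dmat V] vanishes, so each diagonal entry is the mean of its
    differences with the others, and a difference of two diagonal entries is an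
    off-diagonal one in the frame rotated by 45 degrees. *)
Lemma haar_expR_vec x (t : R) : dot x x = 1 -> t ^+ 2 <= 1 / 900 ->
  \int[sigma]_V expR (t * bil (Dmat V) x x) <= 4 * expR 3.
Proof.
move=> x1 t2.
pose F (u : R) := expR (t * ((d%:R * u - m%:R) / Num.sqrt q%:R)).
have FE V y : dot y y = 1 -> expR (t * bil (Dmat V) y y) = F (bil (pr V) y y).
  by move=> y1; rewrite bil_Dmat y1 mulr1.
have dd i : dot (delta_mx i 0 : 'cV[R]_d) (delta_mx i 0) = 1.
  by rewrite dot_delta eqxx.
have bF a b : bdmeas (fun V : gr => expR (t * bil (Dmat V) a b)).
  by apply: bdmeas_expR; apply: bdmeasZ; exact: bdmeas_Dmat.
under eq_Rintegral do rewrite (FE _ _ x1).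
rewrite (@haar_vec F x (delta_mx i0 0)) ?x1 ?dd//; last first.
  by under eq_fun do rewrite -FE//.
pose dl i : 'cV[R]_d := delta_mx i 0.
pose Y i V := bil (Dmat V) (dl i0) (dl i0) - bil (Dmat V) (dl i) (dl i).
have bY i : bdmeas (fun V => expR (t * Y i V)).
  by apply: bdmeas_expR; apply: bdmeasZ; apply: bdmeasB; exact: bdmeas_Dmat.
have sumY V : \sum_i d%:R^-1 * (t * Y i V) = t * bil (Dmat V) (dl i0) (dl i0).
  rewrite -!mulr_sumr sumrB sumr_const card_ord.
  have -> : \sum_i bil (Dmat V) (dl i) (dl i) = 0.
    under eq_bigr do rewrite bil_Dmat dd mulr1 bil_delta.
    rewrite -mulr_suml sumrB -mulr_sumr (proj_sum_diag (pr_isproj V)).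
    by rewrite sumr_const card_ord -[m%:R *+ d]mulr_natl subrr mul0r.
  by rewrite subr0 -[_ *+ d]mulr_natl; field; rewrite gt_eqF.
have p1 : \sum_(i < d) d%:R^-1 = 1 :> R.
  by rewrite sumr_const card_ord -[_ *+ d]mulr_natr mulVf// gt_eqF.
apply: (@le_trans _ _ (\int[sigma]_V (\sum_i d%:R^-1 * expR (t * Y i V)))).
  apply: le_Ex.
  - by under eq_fun do rewrite -FE//.
  - by apply: bdmeas_sum => i; apply: bdmeasZ.
  - move=> V; rewrite -FE// -sumY; apply: le_trans (jensen_expR _ _ _) _.
    + by move=> i; rewrite invr_ge0 ltW.
    + by rewrite p1.
    + by rewrite p1 subrr add0r.
rewrite Ex_sum; last by move=> i; apply: bdmeasZ.
have -> : 4 * expR 3 = \sum_(i < d) d%:R^-1 * (4 * expR 3) :> R.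
  by rewrite -mulr_suml p1 mul1r.
apply: ler_sum => i _.
rewrite (ExZ sigma _ (bY i)) ler_wpM2l ?invr_ge0 ?(ltW dR0)//.
have [->|ii0] := eqVneq i i0.
  under eq_Rintegral do rewrite /Y subrr mulr0 expR0.
  by rewrite Ex_cst; have := @expR_ge1Dx R 3; lra.
have on := onpair_delta R ii0; have on45 := onpair_rot45 (onpair_sym on).
have -> : \int[sigma]_V expR (t * Y i V) = \int[sigma]_V expR ((2 * t) *
    (d%:R / Num.sqrt q%:R * bil (pr V) (rot45l (dl i0) (dl i)) (rot45r (dl i0) (dl i)))).
  apply: eq_Rintegral => V _; congr expR.
  have [_ _ o] := on45.
  have -> : Y i V = 2 * bil (Dmat V) (rot45l (dl i0) (dl i)) (rot45r (dl i0) (dl i)).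
    by rewrite bil_rot45 ?Dmat_tr// /Y; field.
  by rewrite bil_Dmat o mulr0 subr0; ring.
by apply: haar_expR_orth => //; rewrite exprMn; lra.
Qed.

Lemma haar_entry (F : R -> R) i j : bdmeas (fun V : gr => F (pr V j j)) ->
  \int[sigma]_V F (pr V i i) = \int[sigma]_V F (pr V j j).
Proof.
move=> bF.
transitivity (\int[sigma]_V F (bil (pr V) (delta_mx i 0) (delta_mx i 0))).
  by apply: eq_Rintegral => V _; rewrite bil_delta.
rewrite (@haar_vec F _ (delta_mx j 0)) ?dot_delta ?eqxx//.
  by apply: eq_Rintegral => V _; rewrite bil_delta.
by under eq_fun do rewrite bil_delta.
Qed.

Lemma haar_entries (F : R -> R -> R -> R) i j k l : i != j -> k != l ->
  bdmeas (fun V : gr => F (pr V k k) (pr V k l) (pr V l l)) ->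
  \int[sigma]_V F (pr V i i) (pr V i j) (pr V j j)
  = \int[sigma]_V F (pr V k k) (pr V k l) (pr V l l).
Proof.
move=> ij kl bF; pose dl i : 'cV[R]_d := delta_mx i 0.
transitivity (\int[sigma]_V F (bil (pr V) (dl i) (dl i)) (bil (pr V) (dl i) (dl j))
   (bil (pr V) (dl j) (dl j))).
  by apply: eq_Rintegral => V _; rewrite !bil_delta.
rewrite (haar_onpair (F := F) (onpair_delta R ij) (onpair_delta R kl)).
  by apply: eq_Rintegral => V _; rewrite !bil_delta.
by under eq_fun do rewrite !bil_delta.
Qed.

Lemma haar_mean i : \int[sigma]_V pr V i i = m%:R / d%:R.
Proof.
have E j : \int[sigma]_V pr V j j = \int[sigma]_V pr V i i.
  by apply: (haar_entry (F := id)); exact: bdmeas_entry.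
have : \int[sigma]_V (\sum_j pr V j j) = m%:R.
  by under eq_Rintegral do rewrite (proj_sum_diag (pr_isproj _)); exact: Ex_cst.
rewrite Ex_sum; last by move=> j; exact: bdmeas_entry.
under eq_bigr do rewrite E.
rewrite sumr_const card_ord -[LHS]mulr_natr => <-.
by rewrite mulfK// gt_eqF.
Qed.

(* The second moments of the entries are [al], [be] and [ga]. Rotation by 45 degrees,
   idempotence and the trace each give one linear equation between them. *)
Let al := \int[sigma]_V (pr V i0 i0 ^+ 2).
Let be := \int[sigma]_V (pr V i0 i0 * pr V i1 i1).
Let ga := \int[sigma]_V (pr V i0 i1 ^+ 2).

Lemma haar_ga i j : i != j -> \int[sigma]_V (pr V i j ^+ 2) = ga.
Proof.
move=> ij; apply: (haar_entries (F := fun _ v _ => v ^+ 2)) => //.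
by apply: bdmeasX; exact: bdmeas_entry.
Qed.

Lemma haar_be i j : i != j -> \int[sigma]_V (pr V i i * pr V j j) = be.
Proof.
move=> ij; apply: (haar_entries (F := fun u _ v => u * v)) => //.
by apply: bdmeasM; exact: bdmeas_entry.
Qed.

Let ga_diff : 4 * ga = \int[sigma]_V ((pr V i0 i0 - pr V i1 i1) ^+ 2).
Proof.
have on := onpair_delta R i01; pose dl i : 'cV[R]_d := delta_mx i 0.
have bE a b : bdmeas (fun V : gr => bil (pr V) a b ^+ 2).
  by apply: bdmeasX; exact: bdmeas_bil.
have -> : ga = \int[sigma]_V (bil (pr V) (dl i0) (dl i1) ^+ 2).
  by apply: eq_Rintegral => V _; rewrite bil_delta.
rewrite -(haar_onpair (F := fun _ v _ => v ^+ 2) (onpair_rot45 on) on)// -ExZ//.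
apply: eq_Rintegral => V _.
by rewrite (bil_rot45 _ _ (proj_tr (pr_isproj _))) !bil_delta; field.
Qed.

Let al_diff : 4 * ga = 2 * al - 2 * be.
Proof.
rewrite ga_diff.
have -> : \int[sigma]_V ((pr V i0 i0 - pr V i1 i1) ^+ 2) =
  \int[sigma]_V (pr V i0 i0 ^+ 2 + pr V i1 i1 ^+ 2 - 2 * (pr V i0 i0 * pr V i1 i1)).
  by apply: eq_Rintegral => V _; ring.
have bX i : bdmeas (fun V : gr => pr V i i ^+ 2) by apply: bdmeasX; exact: bdmeas_entry.
have bM : bdmeas (fun V : gr => pr V i0 i0 * pr V i1 i1).
  by apply: bdmeasM; exact: bdmeas_entry.
rewrite ExB; [|exact: bdmeasD|exact: bdmeasZ].
rewrite ExD// ExZ// -/be -/al.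
have -> : \int[sigma]_V (pr V i1 i1 ^+ 2) = al.
  exact: (haar_entry (F := fun u => u ^+ 2)).
by ring.
Qed.

Let al_ga : al + (d%:R - 1) * ga = m%:R / d%:R.
Proof.
have := haar_mean i0.
have -> : \int[sigma]_V pr V i0 i0 = \int[sigma]_V (\sum_j pr V i0 j ^+ 2).
  by apply: eq_Rintegral => V _; rewrite (proj_row_sqr (pr_isproj V)).
rewrite Ex_sum; last by move=> j; apply: bdmeasX; exact: bdmeas_entry.
rewrite (bigD1 i0)//= -/al (eq_bigr (fun=> ga)); last first.
  by move=> j jN; rewrite haar_ga// eq_sym.
rewrite sumr_const cardC1 card_ord -[ga *+ _]mulr_natl => <-.
by rewrite -subn1 natrB.
Qed.

Let al_be : al + (d%:R - 1) * be = m%:R ^+ 2 / d%:R.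
Proof.
have : \int[sigma]_V (\sum_j pr V i0 i0 * pr V j j) = m%:R ^+ 2 / d%:R.
  under eq_Rintegral do rewrite -mulr_sumr (proj_sum_diag (pr_isproj _)) mulrC.
  by rewrite ExZ ?haar_mean ?mulrA//; exact: bdmeas_entry.
rewrite Ex_sum; last by move=> j; apply: bdmeasM; exact: bdmeas_entry.
rewrite (bigD1 i0)//= (eq_bigr (fun=> be)); last first.
  by move=> j jN; rewrite haar_be// eq_sym.
rewrite sumr_const cardC1 card_ord -[be *+ _]mulr_natl => <-.
by rewrite -subn1 natrB.
Qed.

Lemma haar_offdiag_moment :
  ga * (d%:R * (d%:R - 1) * (d%:R + 2)) = m%:R * (d%:R - m%:R).
Proof.
have h1 : d%:R * al + d%:R * (d%:R - 1) * ga = m%:R.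
  have := al_ga => /(congr1 (fun z => d%:R * z)).
  by rewrite mulrDr mulrA => ->; rewrite mulrCA mulfV ?mulr1// gt_eqF.
have h2 : d%:R * al + d%:R * (d%:R - 1) * be = m%:R ^+ 2.
  have := al_be => /(congr1 (fun z => d%:R * z)).
  by rewrite mulrDr mulrA => ->; rewrite mulrCA mulfV ?mulr1// gt_eqF.
have h3 : be = al - 2 * ga by have := al_diff; lra.
have : d%:R * (d%:R * al + d%:R * (d%:R - 1) * ga) -
   (d%:R * al + d%:R * (d%:R - 1) * be) = d%:R * m%:R - m%:R ^+ 2.
  by rewrite h2 h1.
rewrite h3 => h.
have -> : m%:R * (d%:R - m%:R) = d%:R * m%:R - m%:R ^+ 2 :> R by ring.
by rewrite -h; ring.
Qed.

(** The exact value of [ga] is bounded below using [m * (d - m) >= q * d / 2] for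
    [q = minn m (d - m)]. *)
Lemma haar_second_moment e f : onpair e f ->
  1 <= \int[sigma]_V ((bil (Dmat V) e e - bil (Dmat V) f f) ^+ 2).
Proof.
move=> ef; have [ee ff _] := ef.
have bB a b : bdmeas (fun V : gr => (bil (pr V) a a - bil (pr V) b b) ^+ 2).
  by apply: bdmeasX; apply: bdmeasB; exact: bdmeas_bil.
have E : \int[sigma]_V ((bil (pr V) e e - bil (pr V) f f) ^+ 2) = 4 * ga.
  rewrite (haar_onpair (F := fun u _ v => (u - v) ^+ 2) ef (onpair_delta R i01))//.
  by rewrite ga_diff; apply: eq_Rintegral => V _; rewrite !bil_delta.
have -> : \int[sigma]_V ((bil (Dmat V) e e - bil (Dmat V) f f) ^+ 2) =
   \int[sigma]_V (d%:R ^+ 2 / q%:R * (bil (pr V) e e - bil (pr V) f f) ^+ 2).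
  apply: eq_Rintegral => V _; rewrite !bil_Dmat ee ff -[X in _ / X * _]sqr_sqrtr ?ltW//.
  by field; rewrite gt_eqF.
rewrite ExZ// E.
rewrite mulrAC ler_pdivlMr// mul1r.
have hv := haar_offdiag_moment.
have dm0 : 0 < d%:R * (d%:R - 1) * (d%:R + 2) :> R.
  have d1 : 0 < d%:R - 1 :> R by rewrite subr_gt0 ltr1n.
  by rewrite !mulr_gt0// addr_gt0.
rewrite -(ler_pM2r dm0).
have -> : d%:R ^+ 2 * (4 * ga) * (d%:R * (d%:R - 1) * (d%:R + 2)) =
  4 * d%:R ^+ 2 * (m%:R * (d%:R - m%:R)) by rewrite -hv; ring.
have qle : q%:R * d%:R <= 2 * (m%:R * (d%:R - m%:R)) :> R.
  rewrite -natrB ?(ltnW hmd)// -!natrM ler_nat /q; nia.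
have dd : (d%:R - 1) * (d%:R + 2) <= 2 * d%:R ^+ 2 :> R.
  have : 1 <= d%:R :> R by rewrite ler1n.
  have := sqr_ge0 (d%:R - 1 : R); rewrite sqrrB; nra.
have -> : q%:R * (d%:R * (d%:R - 1) * (d%:R + 2)) =
  (q%:R * d%:R) * ((d%:R - 1) * (d%:R + 2)) :> R by ring.
apply: (@le_trans _ _ ((q%:R * d%:R) * (2 * d%:R ^+ 2))).
  by rewrite ler_wpM2l// mulr_ge0.
apply: (@le_trans _ _ ((2 * (m%:R * (d%:R - m%:R))) * (2 * d%:R ^+ 2))).
  by rewrite ler_wpM2r// mulr_ge0// sqr_ge0.
by rewrite le_eqVlt; apply/orP; left; apply/eqP; ring.
Qed.

End HaarMoments.

(** * Tails and small-ball estimate *)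

Section SmallBall.
Context (R : realType) (m d : nat) (hm : (0 < m)%N) (hmd : (m < d)%N).
Local Notation gr := (gr_borel R (ltnW hmd)).
Context (sigma : probability gr R) (hsigma : is_haar sigma).
Implicit Types (a b e f x y : 'cV[R]_d).

Let d0 : (0 < d)%N. Proof. exact: leq_ltn_trans hmd. Qed.
Let d2 : (1 < d)%N. Proof. exact: leq_ltn_trans hmd. Qed.

Lemma onpair_exists x : dot x x = 1 -> exists y, onpair x y.
Proof.
move=> x1; pose dl i : 'cV[R]_d := delta_mx i 0.
have dd : dot (dl (Ordinal d0)) (dl (Ordinal d0)) = dot x x.
  by rewrite dot_delta eqxx x1.
have [Q QQ [Qx _ _]] := householder dd.
exists (Q *m dl (Ordinal d2)); rewrite -Qx; apply: onpair_orth => //.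
exact: onpair_delta.
Qed.

(** [e] and [f] bisect [a] and [b], internally and externally. *)
Lemma bisectors a b : dot a a = 1 -> dot b b = 1 ->
  exists e f c s, [/\ onpair e f, c ^+ 2 + s ^+ 2 = 1,
    a = c *: e + s *: f & b = c *: e - s *: f].
Proof.
move=> aa bb.
have [ab|abN] := eqVneq (a + b) 0.
  have [e [_ ee ae]] := onpair_exists aa.
  exists e, a, 0, 1; rewrite expr0n expr1n add0r !scale0r scale1r add0r sub0r.
  by split=> //; [split=> //; rewrite dotC|apply/eqP; rewrite -addr_eq0 addrC ab].
have [ab|abN'] := eqVneq (a - b) 0.
  have [f af] := onpair_exists aa.
  exists a, f, 1, 0; rewrite expr0n expr1n addr0 !scale0r scale1r addr0 subr0.
  by split=> //; apply/eqP; rewrite eq_sym -subr_eq0 ab.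
exists ((vnorm (a + b))^-1 *: (a + b)), ((vnorm (a - b))^-1 *: (a - b)).
exists (vnorm (a + b) / 2), (vnorm (a - b) / 2); split.
- split; rewrite ?unit_vec//.
  by rewrite dotZl dotZr !(dotBr, dotDl) aa bb (dotC b a); ring.
- by rewrite !exprMn !vnorm_sqr !(dotBl, dotBr, dotDl, dotDr) aa bb (dotC b a); field.
- rewrite !scalerA ![_ / 2]mulrC !mulfK ?vnorm_eq0// -scalerDr addrACA subrr addr0.
  by rewrite -mulr2n -(scaler_nat 2 a) scalerA mulVf// scale1r.
- rewrite !scalerA ![_ / 2]mulrC !mulfK ?vnorm_eq0// -scalerBr opprB [a + b]addrC.
  by rewrite addrACA subrr addr0 -mulr2n -(scaler_nat 2 b) scalerA mulVf// scale1r.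
Qed.

(** Both constants are universal: they involve neither the rank nor the
    dimension. *)
Definition tail_const : R := 8 * expR 3.
Definition fourth_const : R := 256 * 30 ^+ 4 * tail_const.

Lemma tail_const_ge1 : 1 <= tail_const.
Proof. by rewrite /tail_const; have := @expR_ge1Dx R 3; lra. Qed.

Lemma fourth_const_ge1 : 1 <= fourth_const.
Proof.
rewrite /fourth_const; have := tail_const_ge1; have : 1 <= 256 * 30 ^+ 4 :> R.
  by rewrite -natrX -natrM ler1n.
set u := _ * _ ^+ _; set v := tail_const; move=> u1 v1.
by rewrite -[1]mulr1 ler_pM.
Qed.

Lemma expR_norm_le (u : R) : expR `|u| <= expR u + expR (- u).
Proof.
have [u0|u0] := leP 0 u; first by rewrite ger0_norm// lerDl expR_ge0.
by rewrite ltr0_norm// lerDr expR_ge0.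
Qed.

Lemma bdmeas_expR_norm (t : R) a b :
  bdmeas (fun V : gr => expR (t * `|bil (Dmat V) a b|)).
Proof. by apply: bdmeas_expR; apply: bdmeasZ; apply: bdmeas_norm; exact: bdmeas_Dmat. Qed.

Lemma haar_tail x : vnorm x <= 1 ->
  \int[sigma]_V expR (30^-1 * `|bil (Dmat V) x x|) <= tail_const.
Proof.
have [->|x0] := eqVneq x 0.
  move=> _; under eq_Rintegral do rewrite bil0l normr0 mulr0 expR0.
  by rewrite Ex_cst tail_const_ge1.
move=> x1; set y := (vnorm x)^-1 *: x; have y1 : dot y y = 1 := unit_vec x0.
have bT (t : R) : bdmeas (fun V : gr => expR (t * bil (Dmat V) y y)).
  by apply: bdmeas_expR; apply: bdmeasZ; exact: bdmeas_Dmat.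
apply: (@le_trans _ _ (\int[sigma]_V (expR (30^-1 * bil (Dmat V) y y)
    + expR (- 30^-1 * bil (Dmat V) y y)))).
  apply: le_Ex; [exact: bdmeas_expR_norm|exact: bdmeasD|move=> V].
  rewrite mulNr; apply: le_trans (expR_norm_le _); rewrite ler_expR.
  rewrite normrM ger0_norm ?invr_ge0// ler_wpM2l ?invr_ge0//.
  rewrite [in leLHS](unit_vecK x0) -/y bilZl bilZr mulrA normrM ler_piMl//.
  by rewrite normrM !ger0_norm ?vnorm_ge0// mulr_ile1 ?vnorm_ge0.
rewrite ExD// (_ : tail_const = 4 * expR 3 + 4 * expR 3); last by rewrite /tail_const; ring.
by apply: lerD; apply: (haar_expR_vec hm hsigma y1); lra.
Qed.

(** From [z <= expR z] at [z = `|Z V| / 60], raised to the fourth power, and the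
    exponential moment. *)
Lemma haar_fourth_moment e f : onpair e f ->
  \int[sigma]_V ((bil (Dmat V) e e - bil (Dmat V) f f) ^+ 4) <= fourth_const.
Proof.
move=> ef; have ef45 := onpair_rot45 ef; have [_ _ o] := ef45.
pose Z (V : gr) := (d%:R / Num.sqrt (minn m (d - m))%:R *
   bil (pr V) (rot45l e f) (rot45r e f)) : R.
have ZE (V : gr) : bil (Dmat V) e e - bil (Dmat V) f f = 2 * Z V.
  have := bil_rot45 e f (Dmat_tr V); rewrite bil_Dmat o mulr0 subr0 => h.
  by rewrite /Z mulrAC h; field.
have bZ (t : R) : bdmeas (fun V : gr => expR (t * Z V)).
  by apply: bdmeas_expR; apply: bdmeasZ; apply: bdmeasZ; exact: bdmeas_bil.
have bD : bdmeas (fun V : gr => bil (Dmat V) e e - bil (Dmat V) f f).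
  by apply: bdmeasB; exact: bdmeas_Dmat.
apply: (@le_trans _ _ (\int[sigma]_V (256 * 30 ^+ 4 *
    (expR (15^-1 * Z V) + expR (- 15^-1 * Z V))))).
  apply: le_Ex; [exact: bdmeasX|by apply: bdmeasZ; exact: bdmeasD|move=> V].
  rewrite ZE mulNr; apply: le_trans (_ : _ <= 256 * 30 ^+ 4 * expR `|15^-1 * Z V|) _; last first.
    by rewrite ler_pM2l ?expR_norm_le// -natrX -natrM ltr0n.
  rewrite normrM ger0_norm ?invr_ge0//; set z := `|Z V|.
  have -> : (2 * Z V) ^+ 4 = 256 * 30 ^+ 4 * (z / 60) ^+ 4.
    have -> : (2 * Z V) ^+ 4 = (2 ^+ 2 * z ^+ 2) ^+ 2.
      by rewrite /z real_normK ?num_real//; ring.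
    by field.
  rewrite ler_pM2l; last by rewrite -natrX -natrM ltr0n.
  have -> : 15^-1 * z = 4 * (z / 60) by field.
  rewrite expRM_natl lerXn2r ?nnegrE ?expR_ge0// ?divr_ge0 ?normr_ge0//.
  by have := expR_ge1Dx (z / 60); lra.
rewrite ExZ; last exact: bdmeasD.
rewrite ExD// ler_pM2l; last by rewrite -natrX -natrM ltr0n.
rewrite (_ : tail_const = 4 * expR 3 + 4 * expR 3); last by rewrite /tail_const; ring.
by apply: lerD; apply: haar_expR_orth => //; rewrite ?sqrrN; lra.
Qed.

(** Truncation level and slope of a Paley-Zygmund argument: the level is chosen so
    that the fourth moment divided by its square is at most one half. *)
Definition pz_level : R := 2 * fourth_const.
Definition pz_slope : R := (pz_level * (2 + pz_level))^-1.

Lemma pz_level_ge2 : 2 <= pz_level.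
Proof. by rewrite /pz_level; have := fourth_const_ge1; lra. Qed.

Lemma pz_slope_gt0 : 0 < pz_slope.
Proof. by rewrite invr_gt0 mulr_gt0//; have := pz_level_ge2; lra. Qed.

Lemma pz_slope_le1 : pz_slope <= 1.
Proof.
rewrite invf_le1 ?mulr_gt0//; have := pz_level_ge2; try lra.
by move=> h; rewrite -[1]mulr1 ler_pM//; lra.
Qed.

(** The gap below 1 is at least a multiple of [y ^+ 2] up to the level
    [pz_level], beyond which the right-hand side is negative. *)
Lemma expR_half_norm_le (y : R) :
  expR (- (`|y| / 2)) <= 1 - pz_slope * (y ^+ 2 - y ^+ 4 / pz_level ^+ 2).
Proof.
have L2 := pz_level_ge2; set L := pz_level in L2 *.
set z := `|y|; have z0 : 0 <= z by exact: normr_ge0.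
have -> : y ^+ 2 = z ^+ 2 by rewrite real_normK ?num_real.
have -> : y ^+ 4 = z ^+ 2 * z ^+ 2 by rewrite real_normK ?num_real//; ring.
have h1 : expR (- (z / 2)) <= 1 - z / (2 + z).
  rewrite expRN -[leLHS]div1r ler_pdivrMr ?expR_gt0//.
  have -> : 1 - z / (2 + z) = (1 + z / 2)^-1 by field; lra.
  by rewrite mulrC ler_pdivlMr ?mul1r; [exact: expR_ge1Dx|lra].
apply: le_trans h1 _; rewrite lerD2l lerN2.
have -> : z ^+ 2 - z ^+ 2 * z ^+ 2 / L ^+ 2 = z ^+ 2 * (1 - z ^+ 2 / L ^+ 2).
  by field; lra.
have [zL|zL] := leP z L; last first.
  apply: (@le_trans _ _ 0); last by rewrite divr_ge0//; lra.
  rewrite mulr_ge0_le0 ?(ltW pz_slope_gt0)// mulr_ge0_le0 ?sqr_ge0//.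
  rewrite subr_le0 ler_pdivlMr ?exprn_gt0// ?mul1r; last lra.
  by rewrite lerXn2r ?nnegrE//; lra.
apply: (@le_trans _ _ (pz_slope * (z * L))).
  rewrite ler_pM2l ?pz_slope_gt0// expr2 -mulrA ler_wpM2l//.
  apply: le_trans (_ : _ <= z * 1) _; last by rewrite mulr1.
  by rewrite ler_wpM2l// gerBl divr_ge0 ?mulr_ge0// sqr_ge0.
have -> : pz_slope * (z * L) = z / (2 + L).
  by rewrite /pz_slope -/L; field; lra.
by rewrite ler_wpM2l// lef_pV2 ?posrE; lra.
Qed.

Lemma haar_expR_diag_diff e f : onpair e f ->
  \int[sigma]_V expR (- (`|bil (Dmat V) e e - bil (Dmat V) f f| / 2))
  <= 1 - pz_slope / 2.
Proof.
move=> ef.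
pose Y (V : gr) := bil (Dmat V) e e - bil (Dmat V) f f.
have bY : bdmeas Y by apply: bdmeasB; exact: bdmeas_Dmat.
have b2 : bdmeas (fun V => Y V ^+ 2) by exact: bdmeasX.
have b4 : bdmeas (fun V => (pz_level ^+ 2)^-1 * Y V ^+ 4).
  by apply: bdmeasZ; exact: bdmeasX.
apply: (@le_trans _ _ (\int[sigma]_V
   (1 - pz_slope * (Y V ^+ 2 - (pz_level ^+ 2)^-1 * Y V ^+ 4)))).
  apply: le_Ex.
  - apply: bdmeas_expR; apply: bdmeasN; under eq_fun do rewrite mulrC.
    by apply: bdmeasZ; exact: bdmeas_norm.
  - apply: bdmeasB; first exact: bdmeas_cst.
    by apply: bdmeasZ; exact: bdmeasB.
  - by move=> V; rewrite [_^-1 * _]mulrC; exact: expR_half_norm_le.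
rewrite ExB; [|exact: bdmeas_cst|by apply: bdmeasZ; exact: bdmeasB].
rewrite ExZ; last exact: bdmeasB.
rewrite Ex_cst ExB// ExZ; last exact: bdmeasX.
rewrite lerD2l lerN2 ler_pM2l ?pz_slope_gt0//.
have h2 := haar_second_moment hm hsigma ef; have h4 := haar_fourth_moment ef.
have C1 := fourth_const_ge1.
have : (pz_level ^+ 2)^-1 * \int[sigma]_V (Y V ^+ 4) <= 2^-1; last by rewrite -/(Y _) in h2 *; lra.
rewrite mulrC ler_pdivrMr; last by rewrite exprn_gt0//; have := pz_level_ge2; lra.
by apply: le_trans h4 _; rewrite /pz_level exprMn; nra.
Qed.

(** Swapping the bisectors [e] and [f] of [a] and [b] preserves the law of the
    bilinear form and changes its value by a difference of diagonal entries, so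
    one of the two values is far from [- s], whatever [s] is. *)
Lemma haar_small_ball a b (s : R) : dot a a = 1 -> dot b b = 1 ->
  \int[sigma]_V expR (- `|s + bil (Dmat V) a b|) <= 1 - pz_slope / 4.
Proof.
move=> aa bb; have [e [f [c [t [ef ct aE bE]]]]] := bisectors aa bb.
have [ee ff _] := ef.
pose F (u v w : R) := expR (- `|s + (c ^+ 2 * ((d%:R * u - m%:R) / Num.sqrt (minn m (d - m))%:R)
   - t ^+ 2 * ((d%:R * w - m%:R) / Num.sqrt (minn m (d - m))%:R))|).
pose X (x y : 'cV[R]_d) (V : gr) :=
  s + (c ^+ 2 * bil (Dmat V) x x - t ^+ 2 * bil (Dmat V) y y).
have FE x y V : onpair x y -> expR (- `|X x y V|) =
    F (bil (pr V) x x) (bil (pr V) x y) (bil (pr V) y y).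
  by case=> xx yy _; rewrite /X !bil_Dmat xx yy !mulr1.
have bX x y : bdmeas (fun V => expR (- `|X x y V|)).
  apply: bdmeas_expR; apply: bdmeasN; apply: bdmeas_norm.
  apply: bdmeasD; first exact: bdmeas_cst.
  by apply: bdmeasB; apply: bdmeasZ; exact: bdmeas_Dmat.
have -> : \int[sigma]_V expR (- `|s + bil (Dmat V) a b|) =
          \int[sigma]_V expR (- `|X e f V|).
  apply: eq_Rintegral => V _; congr (expR (- `|_ + _|)).
  rewrite aE bE !(bilBr, bilDl, bilZl, bilZr) (bilC f e (Dmat_tr V)); ring.
have swap : \int[sigma]_V expR (- `|X e f V|) = \int[sigma]_V expR (- `|X f e V|).
  have fe := onpair_sym ef.
  under eq_Rintegral do rewrite FE//.
  under [RHS]eq_Rintegral do rewrite FE//.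
  apply: (haar_onpair hsigma (F := F)) => //.
  by under eq_fun do rewrite -FE//.
have bY : bdmeas (fun V : gr => expR (- (`|bil (Dmat V) e e - bil (Dmat V) f f| / 2))).
  apply: bdmeas_expR; apply: bdmeasN; under eq_fun do rewrite mulrC.
  by apply: bdmeasZ; apply: bdmeas_norm; apply: bdmeasB; exact: bdmeas_Dmat.
have h : \int[sigma]_V (expR (- `|X e f V|) + expR (- `|X f e V|)) <=
    \int[sigma]_V (1 + expR (- (`|bil (Dmat V) e e - bil (Dmat V) f f| / 2))).
  apply: le_Ex; [exact: bdmeasD|by apply: bdmeasD => //; exact: bdmeas_cst|move=> V].
  have : bil (Dmat V) e e - bil (Dmat V) f f = X e f V - X f e V.
    rewrite -[LHS]mul1r -ct /X; ring.
  move=> ->; set u := X e f V; set v := X f e V.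
  wlog uv : u v / `|u| <= `|v| => [H|].
    have [/H//|/ltW/H] := leP `|u| `|v|.
    by rewrite addrC distrC.
  apply: lerD.
    by rewrite -(expR0 R) ler_expR oppr_le0.
  rewrite ler_expR lerN2 ler_pdivrMr// mulr_natr mulr2n.
  by apply: le_trans (ler_normB _ _) _; rewrite lerD2r.
rewrite ExD// ExD// in h; last exact: bdmeas_cst.
rewrite -swap Ex_cst in h.
have := haar_expR_diag_diff ef; lra.
Qed.

(** Rescaling to unit vectors costs a factor [vnorm a * vnorm b >= 1 / 4], which
    the constant 4 absorbs; it is needed because lattice points do not have length
    exactly 1. *)
Lemma haar_small_ball_half a b (s : R) : 1 / 2 <= vnorm a <= 1 -> 1 / 2 <= vnorm b <= 1 ->
  \int[sigma]_V expR (- (4 * `|s + bil (Dmat V) a b|)) <= 1 - pz_slope / 4.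
Proof.
move=> /andP[a2 a1] /andP[b2 b1].
have a0 : a != 0 by rewrite -vnorm_gt0; lra.
have b0 : b != 0 by rewrite -vnorm_gt0; lra.
set x := (vnorm a)^-1 *: a; set y := (vnorm b)^-1 *: b.
have nab0 : 0 < vnorm a * vnorm b by rewrite mulr_gt0// vnorm_gt0.
have nab : 1 / 4 <= vnorm a * vnorm b.
  by rewrite (_ : 1 / 4 = (1 / 2) * (1 / 2) :> R) ?ler_pM//; field.
apply: le_trans (haar_small_ball (s / (vnorm a * vnorm b)) (unit_vec a0) (unit_vec b0)).
have bE (t u : R) z w : bdmeas (fun V : gr => expR (- (t * `|u + bil (Dmat V) z w|))).
  apply: bdmeas_expR; apply: bdmeasN; apply: bdmeasZ; apply: bdmeas_norm.
  by apply: bdmeasD; [exact: bdmeas_cst|exact: bdmeas_Dmat].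
apply: le_Ex => //.
  by have := bE 1 (s / (vnorm a * vnorm b)) x y; under eq_fun do rewrite mul1r.
move=> V; rewrite ler_expR lerN2.
have -> : s + bil (Dmat V) a b =
   (vnorm a * vnorm b) * (s / (vnorm a * vnorm b) + bil (Dmat V) x y).
  rewrite {1}(unit_vecK a0) {1}(unit_vecK b0) -/x -/y bilZl bilZr.
  by field; rewrite !vnorm_eq0 a0 b0.
rewrite normrM (gtr0_norm nab0) mulrA ler_peMl//; lra.
Qed.

End SmallBall.

(** * Chernoff bound for independent copies *)

Section Independence.
Context (R : realType) (dO dG : measure_display) (O : measurableType dO)
  (G : measurableType dG) (P : probability O R) (sigma : probability G R)
  (n : nat) (V : 'I_n -> {mfun O >-> G}).
Hypothesis hV : forall (i : 'I_n) (B : set G), measurable B ->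
  distribution P (V i) B = sigma B.
Hypothesis indV : mutually_independent P V.

Lemma measurable_V i (B : set G) : measurable B -> measurable (V i @^-1` B).
Proof. by move=> mB; rewrite -[X in measurable X]setTI; exact: measurable_funP. Qed.

Lemma bdmeas_V i (f : G -> R) : bdmeas f -> bdmeas (fun w => f (V i w)).
Proof.
move=> [mf [M fM]]; split; first exact: measurableT_comp.
by exists M => w.
Qed.

Lemma bdmeas_sum_V (f : G -> R) : bdmeas f -> bdmeas (fun w => \sum_i f (V i w)).
Proof. by move=> bf; apply: bdmeas_sum => i; exact: bdmeas_V. Qed.

Lemma fine_prodE (I : finType) (F : I -> \bar R) : (forall i, F i \is a fin_num) ->
  fine (\prod_i F i)%E = \prod_i fine (F i).
Proof.
move=> Ff; suff : (\prod_i F i)%E = (\prod_i fine (F i))%:E by move=> ->.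
elim/big_ind2 : _ => // [x1 x2 y1 y2 -> ->|i _]; first by rewrite EFinM.
by rewrite fineK.
Qed.

Lemma indep_events (B : 'I_n -> set G) : (forall i, measurable (B i)) ->
  fine (P (\bigcap_(i in [set: 'I_n]) (V i @^-1` B i))) = \prod_i fine (sigma (B i)).
Proof.
move=> mB; have := indV [set: 'I_n]%SET mB.
rewrite (_ : [set` _] = [set: 'I_n]); last first.
  apply/seteqP; split=> i _ //.
  by have : i \in [set: 'I_n]%SET by rewrite finset.inE.
move=> ->.
under [X in fine X]eq_bigl => i.
  rewrite (_ : _ \in _ = true); last by rewrite finset.inE.
  over.
rewrite (eq_bigr (fun i => sigma (B i))); last by move=> i _; exact: hV.
by rewrite fine_prodE// => i; exact: fin_num_measure.
Qed.

(** Expand the product of sums over all choice functions: each term is the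
    indicator of an intersection of events, one for each variable. *)
Lemma indep_simple (L : nat) (c : 'I_L -> R) (B : 'I_L -> set G) :
  (forall l, measurable (B l)) ->
  \int[P]_w (\prod_(i < n) \sum_l c l * \1_(B l) (V i w))
  = (\sum_l c l * fine (sigma (B l))) ^+ n.
Proof.
move=> mB; pose A (g : {ffun 'I_n -> 'I_L}) := \bigcap_(i in [set: 'I_n]) (V i @^-1` B (g i)).
have mA g : measurable (A g).
  apply: fin_bigcap_measurable => // i _; exact: measurable_V.
transitivity (\int[P]_w \sum_(g : {ffun 'I_n -> 'I_L}) (\prod_i c (g i)) * \1_(A g) w).
  apply: eq_Rintegral => w _; rewrite bigA_distr_bigA; apply: eq_bigr => g _.
  rewrite big_split/=; congr (_ * _).
  rewrite indicE; case: (boolP (w \in A g)) => [|wA].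
    by rewrite inE => wA; apply: big1 => i _; rewrite indicE mem_set//; exact: wA.
  have [i iN] : exists i, ~ B (g i) (V i w).
    by apply/existsNP => H; move/negP: wA; apply; rewrite inE => i _; exact: H.
  by rewrite (bigD1 i)//= indicE memNset// mul0r.
rewrite Ex_sum; last by move=> g; apply: bdmeasZ; exact: bdmeas_indic.
under eq_bigr => g _.
  rewrite ExZ; last exact: bdmeas_indic.
  rewrite Ex_indic// indep_events// -big_split/=.
  over.
rewrite -(bigA_distr_bigA (fun (i : 'I_n) l => c l * fine (sigma (B l)))).
by rewrite prodr_const card_ord.
Qed.

(** The exponential of [f] is sandwiched, up to the factor [expR delta], by a
    function taking finitely many values, for which independence of events
    suffices. *)
Lemma indep_expR_sum (f : G -> R) (delta : R) : bdmeas f -> 0 < delta ->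
  \int[P]_w expR (\sum_i f (V i w)) <= (expR delta * \int[sigma]_v expR (f v)) ^+ n.
Proof.
move=> bf de0; have [mf [M fM]] := bf.
(* [B l] is the event that [f] lies in the [l]-th interval of length [delta]
   above [- M], and [expR] is at most [c l] there. *)
pose L := (Num.truncn (2 * M / delta)).+1.
pose g v := (f v + M) / delta.
have mg : measurable_fun setT g.
  by rewrite /g; under eq_fun do rewrite mulrC; apply: measurable_funM => //;
    exact: measurable_funD.
have g0 v : 0 <= g v.
  by rewrite divr_ge0 ?(ltW de0)//; have := fM v; rewrite ler_norml => /andP[]; lra.
have gL v : (Num.truncn (g v) < L)%N.
  rewrite ltnS; apply: le_truncn; rewrite ler_pM2r ?invr_gt0//.
  by have := fM v; rewrite ler_norml => /andP[]; lra.
pose B (l : 'I_L) : set G := [set v | l%:R <= g v] `&` [set v | g v < l.+1%:R].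
have mB l : measurable (B l).
  apply: measurableI; rewrite -[X in measurable X]setTI.
    by apply: measurable_fun_le => //; exact: measurable_cst.
  rewrite [X in _ `&` X](_ : _ = ~` [set v | l.+1%:R <= g v]).
    rewrite setTI; apply: measurableC; rewrite -[X in measurable X]setTI.
    by apply: measurable_fun_le => //; exact: measurable_cst.
  by apply/seteqP; split=> v /=; rewrite ltNge => /negP.
pose c (l : 'I_L) := expR (l.+1%:R * delta - M).
have E v : \sum_l c l * \1_(B l) v = c (Ordinal (gL v)).
  have /andP[t1 t2] := Num.Theory.truncn_itv (g0 v).
  rewrite (bigD1 (Ordinal (gL v)))//= big1 => [|l lN].
    by rewrite addr0 indicE mem_set ?mulr1.
  rewrite indicE memNset ?mulr0// => -[/= l1 l2].
  move/eqP: lN; apply; apply/val_inj => /=.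
  apply/eqP; rewrite eqn_leq; apply/andP; split; rewrite -ltnS -(ltr_nat R).
    exact: le_lt_trans t2.
  exact: le_lt_trans l2.
have lo v : expR (f v) <= \sum_l c l * \1_(B l) v.
  rewrite E /c ler_expR /=.
  have /andP[_ t2] := Num.Theory.truncn_itv (g0 v).
  by move: (ltW t2); rewrite {1}/g ler_pdivrMr//; lra.
have hi v : \sum_l c l * \1_(B l) v <= expR delta * expR (f v).
  rewrite E /c -expRD ler_expR /=.
  have /andP[t1 _] := Num.Theory.truncn_itv (g0 v).
  move: t1; rewrite {2}/g ler_pdivlMr// -natr1 mulrDl mul1r; lra.
have bS : bdmeas (fun v => \sum_l c l * \1_(B l) v).
  by apply: bdmeas_sum => l; apply: bdmeasZ; exact: bdmeas_indic.
have bP : bdmeas (fun w => \prod_(i < n) \sum_l c l * \1_(B l) (V i w)).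
  split.
    apply: measurable_prod => i _.
    exact: (bdmeas_V i bS).1.
  have [N SN] := bS.2; exists (N ^+ n) => w.
  have -> : N ^+ n = \prod_(i < n) N by rewrite prodr_const card_ord.
  by rewrite normr_prod; apply: ler_prod => i _; rewrite normr_ge0 SN.
apply: (@le_trans _ _ (\int[P]_w (\prod_(i < n) \sum_l c l * \1_(B l) (V i w)))).
  apply: le_Ex => //; first by apply: bdmeas_expR; exact: bdmeas_sum_V.
  move=> w; rewrite expR_sum; apply: ler_prod => i _.
  by rewrite expR_ge0/=.
have E2 : \sum_l c l * fine (sigma (B l)) = \int[sigma]_v (\sum_l c l * \1_(B l) v).
  rewrite Ex_sum; last by move=> l; apply: bdmeasZ; exact: bdmeas_indic.
  by apply: eq_bigr => l _; rewrite ExZ ?Ex_indic//; exact: bdmeas_indic.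
rewrite indep_simple// E2 lerXn2r ?nnegrE//.
- apply: Rintegral_ge0 => v _; apply: sumr_ge0 => l _.
  by rewrite mulr_ge0 ?expR_ge0// indicE.
- by rewrite mulr_ge0 ?expR_ge0// Rintegral_ge0// => v _; exact: expR_ge0.
- rewrite -ExZ; last exact: bdmeas_expR.
  by apply: le_Ex => //; apply: bdmeasZ; exact: bdmeas_expR.
Qed.

Lemma chernoff (f : G -> R) (delta K : R) : bdmeas f -> 0 < delta ->
  \int[sigma]_v expR (f v) <= K ->
  fine (P [set w | 0 <= \sum_i f (V i w)]) <= (expR delta * K) ^+ n.
Proof.
move=> bf de0 fK; apply: le_trans (expR_markov P (bdmeas_sum_V bf)) _.
apply: le_trans (indep_expR_sum bf de0) _.
have i0 : 0 <= \int[sigma]_v expR (f v).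
  by apply: Rintegral_ge0 => v _; exact: expR_ge0.
rewrite lerXn2r ?nnegrE ?mulr_ge0 ?expR_ge0//; first exact: le_trans fK.
by rewrite ler_wpM2l ?expR_ge0.
Qed.

End Independence.

(** * Lattice nets of sparse vectors *)

Section Nets.
Context (R : realType).

(** [code M] encodes the integers of absolute value at most [M]; a separate
    constructor for 0 makes the zero set of a lattice vector visible. *)
Definition code (M : nat) : finType := (unit + bool * 'I_M)%type.

Definition cval (M : nat) (o : code M) : R :=
  match o with inl _ => 0 | inr (b, j) => (-1) ^+ b * j.+1%:R end.

Definition cnz (M : nat) (o : code M) : bool := if o is inr _ then true else false.

Lemma cnz_cval M (o : code M) : cval o = 0 -> cnz o = false.
Proof.
by case: o => [//|[b j]] /= /eqP; rewrite mulf_eq0 signr_eq0 pnatr_eq0.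
Qed.

(** Truncation towards 0, so that rounding never increases norms or supports. *)
Lemma cval_round (M : nat) (t : R) : `|t| < M.+1%:R ->
  exists o : code M, `|t - cval o| <= 1 /\ `|cval o| <= `|t|.
Proof.
move=> tM; have /andP[k1 k2] := Num.Theory.truncn_itv (normr_ge0 t).
move: k1 k2; set k := Num.truncn _ => k1 k2.
have kM : (k < M.+1)%N by rewrite -(ltr_nat R); apply: le_lt_trans tM.
case: k k1 k2 kM => [_ k2 _|k k1 k2 kM].
  by exists (inl tt) => /=; rewrite subr0 normr0 normr_ge0 ltW.
have kM' : (k < M)%N by [].
have k2' : `|t| < k.+1%:R + 1 by rewrite natr1.
exists (inr (t < 0, Ordinal kM')) => /=.
have [t0|t0] := ltP t 0.
  rewrite expr1 mulN1r normrN (ger0_norm (ler0n _ _)); split=> //.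
  move: k1 k2'; rewrite ltr0_norm// ler_norml => k1 k2'; lra.
rewrite expr0 mul1r (ger0_norm (ler0n _ _)); split=> //.
by move: k1 k2'; rewrite ger0_norm// ler_norml => k1 k2'; lra.
Qed.

Context (d : nat).
Implicit Types (x : 'cV[R]_d) (K M : nat) (h : R).

Definition lpt M (mesh : R) (z : {ffun 'I_d -> code M}) : 'cV[R]_d :=
  \col_i (mesh * cval (z i)).

Definition supp x : {set 'I_d} := [set i | x i 0 != 0]%SET.

Definition lnet M K (N : R) : {set {ffun 'I_d -> code M}} :=
  [set z : {ffun 'I_d -> code M} | (#|[set i | cnz (z i)]%SET| <= K)%N &&
     (\sum_i cval (z i) ^+ 2 <= N)]%SET.

Lemma entry_le_vnorm x i : `|x i 0| <= vnorm x.
Proof.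
rewrite -(@ler_pXn2r _ 2)// ?nnegrE ?vnorm_ge0// vnorm_sqr real_normK ?num_real//.
by rewrite dotE (bigD1 i)//= -expr2 lerDl sumr_ge0// => j _; rewrite -expr2 sqr_ge0.
Qed.

(** Rounding each coordinate of [x] to the mesh [h / Num.sqrt K] makes an error of
    at most one mesh on each of the at most [K] nonzero coordinates. *)
Lemma lnet_approx M K h x : (0 < K)%N -> 0 < h -> Num.sqrt K%:R / h < M.+1%:R ->
  (#|supp x| <= K)%N -> vnorm x <= 1 ->
  exists2 z, z \in lnet M K (K%:R / h ^+ 2) &
    let y := lpt (h / Num.sqrt K%:R) z in
    [/\ supp y \subset supp x, vnorm (x - y) <= h & vnorm y <= vnorm x].
Proof.
move=> K0 h0 hM xK x1; set r := Num.sqrt K%:R.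
have r0 : 0 < r by rewrite sqrtr_gt0 ltr0n.
have r2 : r ^+ 2 = K%:R by rewrite sqr_sqrtr.
pose t := r / h; have t0 : 0 < t by rewrite divr_gt0.
have tV : h / r * t = 1 by rewrite /t; field; rewrite !gt_eqF.
have : forall i : 'I_d, exists o : code M,
    `|x i 0 * t - cval o| <= 1 /\ `|cval o| <= `|x i 0 * t|.
  move=> i; apply: cval_round; apply: le_lt_trans hM.
  rewrite normrM (gtr0_norm t0) ler_piMl ?(ltW t0)//.
  exact: le_trans (entry_le_vnorm x i) x1.
move=> /choice[z0 z0P]; pose z : {ffun 'I_d -> code M} := finfun z0.
have zP i : `|x i 0 * t - cval (z i)| <= 1 /\ `|cval (z i)| <= `|x i 0 * t|.
  by rewrite ffunE; exact: z0P.
have zx i : x i 0 = 0 -> cval (z i) = 0.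
  by move=> xi; have [_] := zP i; rewrite xi mul0r normr0 normr_le0 => /eqP.
have sub : supp (lpt (h / r) z) \subset supp x.
  apply/fintype.subsetP => i; rewrite !finset.inE mxE; apply: contra => /eqP xi.
  by rewrite (zx _ xi) mulr0.
have sq i : cval (z i) ^+ 2 <= (x i 0 * t) ^+ 2.
  by rewrite -real_normK ?num_real// -[leRHS]real_normK ?num_real// lerXn2r ?nnegrE// (zP i).2.
exists z.
  rewrite finset.inE; apply/andP; split.
    apply: leq_trans xK; apply: subset_leq_card; apply/fintype.subsetP => i.
    rewrite !finset.inE; apply: contraTN => /eqP xi.
    by rewrite cnz_cval// zx.
  apply: (@le_trans _ _ (\sum_i (x i 0 * t) ^+ 2)); first exact: ler_sum.
  under eq_bigr do rewrite exprMn.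
  rewrite -mulr_suml -(_ : t ^+ 2 = K%:R / h ^+ 2); last by rewrite /t expr_div_n r2.
  rewrite ler_piMl ?sqr_ge0//.
  under eq_bigr do rewrite expr2.
  by rewrite -dotE -vnorm_sqr expr_le1// ?vnorm_ge0.
split => //.
  rewrite -(@ler_pXn2r _ 2)// ?nnegrE ?vnorm_ge0 ?(ltW h0)// vnorm_sqr dotE.
  under eq_bigr do rewrite -expr2.
  rewrite (bigID (fun i => i \in supp x))/= [X in _ + X]big1 ?addr0; last first.
    move=> i; rewrite finset.inE negbK => /eqP xi.
    by rewrite !mxE zx// xi mulr0 subrr expr0n.
  apply: (@le_trans _ _ (\sum_(i in supp x) (h / r) ^+ 2)).
    apply: ler_sum => i _; rewrite !mxE.
    have -> : x i 0 - h / r * cval (z i) = (h / r) * (x i 0 * t - cval (z i)).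
      by rewrite mulrBr mulrCA tV mulr1.
    rewrite exprMn ler_piMr ?sqr_ge0// -real_normK ?num_real//.
    by rewrite expr_le1// (zP i).1.
  rewrite sumr_const -[leLHS]mulr_natr expr_div_n r2 -mulrA ler_piMr ?sqr_ge0//.
  by rewrite mulrC ler_pdivrMr ?ltr0n// mul1r ler_nat.
rewrite -(@ler_pXn2r _ 2)// ?nnegrE ?vnorm_ge0// !vnorm_sqr !dotE.
apply: ler_sum => i _; rewrite -!expr2 mxE.
have -> : x i 0 = (h / r) * (x i 0 * t) by rewrite mulrCA tV mulr1.
by rewrite [leLHS]exprMn [leRHS]exprMn ler_wpM2l// sqr_ge0.
Qed.

Lemma sum_code_le M (la : R) : 0 <= la ->
  \sum_(o : code M) la ^+ cnz o * expR (- cval o ^+ 2) <= expR (2 * la).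
Proof.
move=> la0; apply: le_trans (expR_ge1Dx _); rewrite big_sumType/=.
rewrite (big_pred1 tt)/=; last by case.
rewrite expr0 mul1r expr0n/= oppr0 expR0 lerD2l.
have -> : \sum_(o : bool * 'I_M) la ^+ 1 * expR (- (let (b, j) := o in
    (-1) ^+ b * j.+1%:R) ^+ 2)
  = \sum_(b : bool) \sum_(j < M) la ^+ 1 * expR (- ((-1) ^+ b * j.+1%:R) ^+ 2).
  by rewrite pair_bigA; apply: eq_bigr => -[b j].
have E (b : bool) : \sum_(j < M) la ^+ 1 * expR (- ((-1) ^+ b * j.+1%:R) ^+ 2) <= la.
  under eq_bigr do rewrite exprMn sqrr_sign mul1r.
  rewrite -mulr_sumr expr1 ler_piMr//.
  have := sum_expR_sqr_le R M.+1; rewrite big_ord_recl/= expr0n/= oppr0 expR0.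
  lra.
apply: le_trans (ler_sum _ (fun b _ => E b)) _.
by rewrite sumr_const card_bool -[_ *+ 2]mulr_natl.
Qed.

(** Exponential Markov inequality for the counting measure: [N - |z|^2 >= 0] and
    [K - #supp z >= 0] on the net, and the generating function factorises over
    the coordinates. *)
Lemma card_lnet M K (N la : R) : 0 < la <= 1 ->
  #|lnet M K N|%:R <= expR N * (la^-1) ^+ K * expR (2 * la * d%:R).
Proof.
move=> /andP[la0 la1].
pose w (o : code M) := la ^+ cnz o * expR (- cval o ^+ 2).
have w0 o : 0 <= w o by rewrite mulr_ge0 ?expR_ge0// exprn_ge0// ltW.
rewrite -sum1_card natr_sum.
apply: (@le_trans _ _ (\sum_(z in lnet M K N)
   expR N * (la^-1) ^+ K * \prod_i w (z i))).
  apply: ler_sum => z; rewrite finset.inE => /andP[zK zN].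
  rewrite big_split/= -expR_sum sumrN.
  rewrite prodrXr (_ : \sum_i cnz (z i) = #|[set i | cnz (z i)]%SET|)%N; last first.
    by rewrite -sum1_card [RHS]big_mkcond; apply: eq_bigr => i _; rewrite finset.inE; case: cnz.
  set s := #|_| in zK *; set S := \sum_i _ in zN *.
  have -> : expR N * la^-1 ^+ K * (la ^+ s * expR (- S)) =
      expR (N - S) * (la^-1 ^+ K * la ^+ s) by rewrite expRD; ring.
  rewrite -[1]mulr1; apply: ler_pM => //.
    by rewrite -(expR0 R) ler_expR subr_ge0.
  by rewrite exprVn mulrC ler_pdivlMr ?exprn_gt0// mul1r ler_wiXn2l// ltW.
apply: (@le_trans _ _ (\sum_(z : {ffun 'I_d -> code M})
   expR N * (la^-1) ^+ K * \prod_i w (z i))).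
  rewrite big_mkcond; apply: ler_sum => z _; case: ifP => // _.
  by rewrite !mulr_ge0 ?expR_ge0 ?exprn_ge0 ?invr_ge0 ?(ltW la0)// prodr_ge0.
rewrite -mulr_sumr ler_wpM2l ?mulr_ge0 ?expR_ge0 ?exprn_ge0 ?invr_ge0 ?(ltW la0)//.
rewrite -(bigA_distr_bigA (fun (i : 'I_d) o => w o)).
rewrite prodr_const card_ord mulrC expRM_natl lerXn2r ?nnegrE ?expR_ge0 ?sumr_ge0//.
exact: sum_code_le (ltW la0).
Qed.

End Nets.

(** * From nets to all sparse vectors *)

Section NetExtension.
Context (R : realType) (d n k : nat) (D : 'I_n -> 'M[R]_d).
Hypothesis DT : forall i, (D i)^T = D i.
Implicit Types (a b x y : 'cV[R]_d) (S : {set 'I_d}).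

Definition Phi a b : R := \sum_i `|bil (D i) a b|.

Lemma Phi_ge0 a b : 0 <= Phi a b.
Proof. by apply: sumr_ge0 => i _; exact: normr_ge0. Qed.

Lemma PhiZ c e a b : Phi (c *: a) (e *: b) = `|c| * `|e| * Phi a b.
Proof.
rewrite /Phi mulr_sumr; apply: eq_bigr => i _.
by rewrite bilZl bilZr !normrM mulrA.
Qed.

Lemma suppZ c x S : supp x \subset S -> supp (c *: x) \subset S.
Proof.
move=> /fintype.subsetP xS; apply/fintype.subsetP => i; rewrite !finset.inE mxE => h.
by apply: xS; rewrite finset.inE; apply: contra h => /eqP ->; rewrite mulr0.
Qed.

Lemma suppD a b S : supp a \subset S -> supp b \subset S -> supp (a + b) \subset S.
Proof.
move=> /fintype.subsetP aS /fintype.subsetP bS; apply/fintype.subsetP => i.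
rewrite !finset.inE mxE; apply: contraR => iS.
have := contra (aS i) iS; have := contra (bS i) iS.
by rewrite !finset.inE !negbK => /eqP -> /eqP ->; rewrite addr0.
Qed.

Lemma suppB a b S : supp a \subset S -> supp b \subset S -> supp (a - b) \subset S.
Proof. by move=> aS bS; apply: suppD => //; rewrite -scaleN1r; exact: suppZ. Qed.

Definition quad_bound (B : R) :=
  forall x, (#|supp x| <= k)%N -> vnorm x <= 1 -> Phi x x <= B.

Lemma quad_bound_hom B x : quad_bound B -> (#|supp x| <= k)%N ->
  Phi x x <= B * vnorm x ^+ 2.
Proof.
move=> hB xk; have [->|x0] := eqVneq x 0.
  rewrite /Phi big1 => [|i _]; last by rewrite bil0l normr0.
  rewrite mulr_ge0 ?sqr_ge0//; apply: le_trans (Phi_ge0 0 0) (hB _ _ _).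
    rewrite (_ : supp 0 = finset.set0) ?cards0//.
    by apply/setP => i; rewrite !finset.inE mxE eqxx.
  by rewrite /vnorm -bil1 bil0l sqrtr0.
rewrite [in leLHS](unit_vecK x0) PhiZ ger0_norm ?vnorm_ge0// -expr2 mulrC.
rewrite ler_wpM2r ?sqr_ge0//; apply: hB.
  by apply: leq_trans xk; apply: subset_leq_card; exact: suppZ.
by rewrite /vnorm (unit_vec x0) sqrtr1.
Qed.

(** Polarisation keeps the constant, because the supports of [a + b] and [a - b]
    stay in [S] and the parallelogram identity holds. *)
Lemma quad_bound_bil B S a b : quad_bound B -> (#|S| <= k)%N ->
  supp a \subset S -> supp b \subset S -> Phi a b <= B * (vnorm a * vnorm b).
Proof.
move=> hB Sk aS bS.
have Phi0 x : Phi 0 x = 0 by apply: big1 => i _; rewrite bil0l normr0.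
have Phi0' x : Phi x 0 = 0 by apply: big1 => i _; rewrite bil0r normr0.
have [->|a0] := eqVneq a 0.
  by rewrite Phi0 (eqP (_ : vnorm 0 == 0)) ?vnorm_eq0// mul0r mulr0.
have [->|b0] := eqVneq b 0.
  by rewrite Phi0' (eqP (_ : vnorm 0 == 0)) ?vnorm_eq0// !mulr0.
rewrite [in leLHS](unit_vecK a0) [in leLHS](unit_vecK b0) PhiZ.
rewrite !ger0_norm ?vnorm_ge0// mulrC ler_wpM2r ?mulr_ge0 ?vnorm_ge0//.
set u := _ *: a; set v := _ *: b.
have uS : supp u \subset S by exact: suppZ.
have vS : supp v \subset S by exact: suppZ.
have u1 : dot u u = 1 by exact: unit_vec.
have v1 : dot v v = 1 by exact: unit_vec.
have h : 4 * Phi u v <= Phi (u + v) (u + v) + Phi (u - v) (u - v).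
  rewrite /Phi mulr_sumr -big_split/=; apply: ler_sum => i _.
  rewrite -[X in X * _](@ger0_norm _ 4)// -normrM polarization//.
  exact: ler_normB.
have h1 : Phi (u + v) (u + v) <= B * vnorm (u + v) ^+ 2.
  by apply: quad_bound_hom => //; apply: leq_trans Sk; apply: subset_leq_card; exact: suppD.
have h2 : Phi (u - v) (u - v) <= B * vnorm (u - v) ^+ 2.
  by apply: quad_bound_hom => //; apply: leq_trans Sk; apply: subset_leq_card; exact: suppB.
have : B * vnorm (u + v) ^+ 2 + B * vnorm (u - v) ^+ 2 = 4 * B.
  by rewrite !vnorm_sqr !(dotBl, dotBr, dotDl, dotDr) u1 v1 (dotC v u); ring.
lra.
Qed.

Lemma Phi_crude x : vnorm x <= 1 -> Phi x x <= \sum_i \sum_j \sum_l `|D i j l|.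
Proof.
move=> x1; apply: ler_sum => i _; rewrite bilE.
apply: le_trans (ler_norm_sum _ _ _) _; apply: ler_sum => j _.
apply: le_trans (ler_norm_sum _ _ _) _; apply: ler_sum => l _.
rewrite !normrM mulrAC ler_piMl//.
by rewrite mulr_ile1//; apply: le_trans (entry_le_vnorm x _) x1.
Qed.

(** The usual bootstrap: the supremum exceeds the bound on the net by at most
    half of itself. *)
Lemma quad_bound_of_net M (U : R) : (0 < k)%N -> Num.sqrt k%:R / 4^-1 < M.+1%:R :> R ->
  (forall z, z \in @lnet R d M k (k%:R / 4^-1 ^+ 2) ->
     let y := lpt (4^-1 / Num.sqrt k%:R) z in vnorm y <= 1 -> Phi y y <= U) ->
  quad_bound (2 * U).
Proof.
move=> k0 hM hU.
pose A : set R := [set t | exists x, [/\ (#|supp x| <= k)%N, vnorm x <= 1 & t = Phi x x]].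
have A0 : A !=set0.
  exists (Phi 0 0), 0; split=> //.
    rewrite (_ : supp 0 = finset.set0) ?cards0//.
    by apply/setP => i; rewrite !finset.inE mxE eqxx.
  by rewrite /vnorm -bil1 bil0l sqrtr0.
have Aub : has_ubound A.
  exists (\sum_i \sum_j \sum_l `|D i j l|) => _ [x [_ x1 ->]]; exact: Phi_crude.
have hB : quad_bound (sup A).
  by move=> x xk x1; apply: ub_le_sup => //; exists x.
suff : sup A <= U + sup A / 2.
  by move=> h x xk x1; apply: le_trans (hB x xk x1) _; lra.
apply: sup_le_ub => // _ [x [xk x1 ->]].
have [//|z zN [yx xy y1]] := lnet_approx k0 _ hM xk x1.
set y := lpt _ z in yx xy y1.
have sA0 : 0 <= sup A by apply: le_trans (Phi_ge0 x x) (hB x xk x1).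
have h1 : Phi x x <= Phi y y + Phi (x - y) (x + y).
  rewrite /Phi -big_split/=; apply: ler_sum => i _.
  have -> : bil (D i) x x = bil (D i) y y + bil (D i) (x - y) (x + y).
    by rewrite bilBl !bilDr (bilC y x (DT i)); ring.
  exact: ler_normD.
have h2 : Phi (x - y) (x + y) <= sup A * (vnorm (x - y) * vnorm (x + y)).
  by apply: (quad_bound_bil hB xk); [exact: suppB|exact: suppD].
have h3 : sup A * (vnorm (x - y) * vnorm (x + y)) <= sup A / 2.
  rewrite ler_wpM2l//; have := vnormD x y => xy2.
  apply: le_trans (_ : _ <= 4^-1 * 2) _; last by lra.
  by apply: ler_pM; rewrite ?vnorm_ge0//; lra.
have h4 : Phi y y <= U by apply: hU => //; exact: le_trans y1 x1.
lra.
Qed.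

(** A shift above [2 * K] dominates the bilinear part by itself, so only shifts in
    a bounded range have to be discretised; for those, the mesh is so fine that the
    upper bound makes all rounding errors smaller than half of the target. *)
Lemma lower_bound_of_net M M' (K ka : R) S a b (s : R) :
  0 < ka <= 1 -> 1 <= K ->
  quad_bound (K * n%:R) -> (0 < k)%N -> (#|S| <= k)%N ->
  Num.sqrt k%:R / (ka / (16 * K)) < M.+1%:R -> 16 * K / ka < M'.+1%:R ->
  (forall z w (o : code M'), z \in @lnet R d M k (k%:R / (ka / (16 * K)) ^+ 2) ->
     w \in @lnet R d M k (k%:R / (ka / (16 * K)) ^+ 2) ->
     let y := lpt (ka / (16 * K) / Num.sqrt k%:R) z in
     let y' := lpt (ka / (16 * K) / Num.sqrt k%:R) w in
     1 / 2 <= vnorm y <= 1 -> 1 / 2 <= vnorm y' <= 1 ->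
     ka * n%:R <= \sum_i `|ka / 8 * cval R o + bil (D i) y y'|) ->
  supp a \subset S -> supp b \subset S -> vnorm a = 1 -> vnorm b = 1 ->
  ka / 2 * n%:R <= \sum_i `|s + bil (D i) a b|.
Proof.
move=> /andP[ka0 ka1] K1 hB k0 Sk hM hM' hN aS bS a1 b1.
have n0 : 0 <= n%:R :> R by exact: ler0n.
have K0 : 0 < K by lra.
have Sab : Phi a b <= K * n%:R.
  by have := quad_bound_bil hB Sk aS bS; rewrite a1 b1 !mulr1.
have [sK|sK] := leP (2 * K) `|s|.
  have h : n%:R * `|s| - Phi a b <= \sum_i `|s + bil (D i) a b|.
    have -> : n%:R * `|s| = \sum_(i < n) `|s| by rewrite sumr_const card_ord mulr_natl.
    rewrite /Phi -sumrB.
    by apply: ler_sum => i _; rewrite lerBlDr -[in leLHS](addrK (bil (D i) a b) s) ler_normB.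
  apply: le_trans h.
  have : n%:R * (2 * K) <= n%:R * `|s| by rewrite ler_wpM2l.
  have : ka / 2 * n%:R <= K * n%:R by rewrite ler_wpM2r//; lra.
  lra.
set h := ka / (16 * K) in hM hN.
have h0 : 0 < h by rewrite divr_gt0// mulr_gt0.
have h16 : h <= 1 / 16.
  by rewrite /h ler_pdivrMr ?mulr_gt0//; lra.
have ak : (#|supp a| <= k)%N by apply: leq_trans Sk; exact: subset_leq_card.
have bk : (#|supp b| <= k)%N by apply: leq_trans Sk; exact: subset_leq_card.
have a1' : vnorm a <= 1 by rewrite a1.
have b1' : vnorm b <= 1 by rewrite b1.
have [z zN [ya aya ya1]] := lnet_approx k0 h0 hM ak a1'.
have [w wN [yb byb yb1]] := lnet_approx k0 h0 hM bk b1'.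
set y := lpt _ z in ya aya ya1; set y' := lpt _ w in yb byb yb1.
have vy : 1 / 2 <= vnorm y.
  by have := vnormD (a - y) y; rewrite subrK; lra.
have vy' : 1 / 2 <= vnorm y'.
  by have := vnormD (b - y') y'; rewrite subrK; lra.
have [|o [so _]] := @cval_round R M' (s / (ka / 8)).
  rewrite normrM (@gtr0_norm _ (ka / 8)^-1) ?invr_gt0 ?divr_gt0//.
  apply: le_lt_trans hM'.
  have -> : 16 * K / ka = 2 * K / (ka / 8) by field; rewrite gt_eqF.
  by rewrite ler_pM2r ?invr_gt0 ?divr_gt0// ltW.
have so' : `|ka / 8 * cval R o - s| <= ka / 8.
  have -> : ka / 8 * cval R o - s = - (ka / 8 * (s / (ka / 8) - cval R o)).
    by field; rewrite gt_eqF.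
  by rewrite normrN normrM gtr0_norm ?divr_gt0// ler_piMr// ltW// divr_gt0.
have yi : 1 / 2 <= vnorm y <= 1 by rewrite vy (le_trans ya1).
have yi' : 1 / 2 <= vnorm y' <= 1 by rewrite vy' (le_trans yb1).
have key : ka * n%:R <= \sum_i `|ka / 8 * cval R o + bil (D i) y y'|.
  exact: hN zN wN yi yi'.
have ySa : supp y \subset S by exact: fintype.subset_trans ya aS.
have ySb : supp y' \subset S by exact: fintype.subset_trans yb bS.
have p1 : Phi (a - y) b <= K * n%:R * h.
  apply: le_trans (quad_bound_bil hB Sk (suppB aS ySa) bS) _.
  by rewrite b1 mulr1 ler_wpM2l// mulr_ge0// ltW.
have p2 : Phi y (b - y') <= K * n%:R * h.
  apply: le_trans (quad_bound_bil hB Sk ySa (suppB bS ySb)) _.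
  rewrite ler_wpM2l ?mulr_ge0 ?(ltW K0)//.
  by rewrite -[leRHS]mul1r ler_pM ?vnorm_ge0// (le_trans ya1).
have tri : \sum_i `|ka / 8 * cval R o + bil (D i) y y'| <=
   \sum_i `|s + bil (D i) a b| + n%:R * (ka / 8) + Phi (a - y) b + Phi y (b - y').
  have -> : n%:R * (ka / 8) = \sum_(i < n) ka / 8 by rewrite sumr_const card_ord mulr_natl.
  rewrite /Phi -!big_split/=.
  apply: ler_sum => i _.
  have -> : ka / 8 * cval R o + bil (D i) y y' = (s + bil (D i) a b) +
     (ka / 8 * cval R o - s) - bil (D i) (a - y) b - bil (D i) y (b - y').
    by rewrite bilBl bilBr; ring.
  apply: le_trans (ler_normB _ _) _; rewrite lerD2r.
  apply: le_trans (ler_normB _ _) _; rewrite lerD2r.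
  by apply: le_trans (ler_normD _ _) _; rewrite lerD2l.
have hK : K * n%:R * h = ka / 16 * n%:R.
  by rewrite /h; field; rewrite gt_eqF.
rewrite hK in p1 p2.
have : 0 <= ka * n%:R by rewrite mulr_ge0// ltW.
lra.
Qed.

End NetExtension.

(** * Measurability of the event *)

Section EventMeasurability.
Context (R : realType) (d k n : nat).
Implicit Types (x y : 'cV[R]_d) (g : {ffun 'I_d -> rat}).

Definition ratvec g : 'cV[R]_d := \col_i ratr (g i).

(** The approximation keeps the support, so that rational approximations of a
    sparse vector are sparse. *)
Lemma ratvec_dense x (e : R) : 0 < e ->
  exists g, (forall i, x i 0 = 0 -> g i = 0) /\
            forall i, `|x i 0 - ratvec g i 0| <= e.
Proof.
move=> e0.
have : forall i : 'I_d, exists q : rat, (x i 0 = 0 -> q = 0) /\ `|x i 0 - ratr q| <= e.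
  move=> i; have [->|xi] := eqVneq (x i 0) 0.
    by exists 0; split=> //; rewrite rmorph0 subrr normr0 ltW.
  have lt : x i 0 - e < x i 0 + e by lra.
  have [q] := rat_in_itvoo lt; rewrite in_itv/= => /andP[q1 q2].
  exists q; split=> [x0|]; first by rewrite x0 eqxx in xi.
  by rewrite ler_distlC; apply/andP; split; lra.
move=> /choice[g0 g0P]; exists (finfun g0); split=> i; rewrite ?mxE ffunE.
  exact: (g0P i).1.
exact: (g0P i).2.
Qed.

Lemma ratvec_seq x : exists u : nat -> {ffun 'I_d -> rat},
  (forall j i, x i 0 = 0 -> u j i = 0) /\
  forall i, ratvec (u j) i 0 @[j --> \oo] --> x i 0.
Proof.
have : forall j : nat, exists g, (forall i, x i 0 = 0 -> g i = 0) /\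
            forall i, `|x i 0 - ratvec g i 0| <= j.+1%:R^-1.
  by move=> j; apply: ratvec_dense; rewrite invr_gt0.
move=> /choice[u uP]; exists u; split=> [j|i]; first exact: (uP j).1.
apply/cvgrPdist_le => e e0; near=> j.
apply: le_trans ((uP j).2 i) _; apply: ltW.
by near: j; exact: (near_infty_natSinv_lt (PosNum e0)).
Unshelve. all: by end_near. Qed.

Lemma sparse_ratvec x g : sparse k x -> (forall i, x i 0 = 0 -> g i = 0) ->
  sparse k (ratvec g).
Proof.
rewrite /sparse => xk xg; apply: leq_trans xk; apply: subset_leq_card.
apply/fintype.subsetP => i; rewrite !finset.inE mxE; apply: contra => /eqP xi.
by rewrite xg// rmorph0.
Qed.

Lemma bil_cvg (A : 'M[R]_d) (u v : nat -> 'cV[R]_d) x y :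
  (forall i, u j i 0 @[j --> \oo] --> x i 0) ->
  (forall i, v j i 0 @[j --> \oo] --> y i 0) ->
  bil A (u j) (v j) @[j --> \oo] --> bil A x y.
Proof.
move=> ux vy; under eq_fun do rewrite bilE; rewrite bilE.
apply: cvg_sumr => i; apply: cvg_sumr => l.
apply: cvgM; last exact: vy.
by apply: cvgM; [exact: ux|exact: cvg_cst].
Qed.

Definition gap x y : R := hs_norm (x *m x^T - y *m y^T).

Lemma gap_cvg (u v : nat -> 'cV[R]_d) x y :
  (forall i, u j i 0 @[j --> \oo] --> x i 0) ->
  (forall i, v j i 0 @[j --> \oo] --> y i 0) ->
  gap (u j) (v j) @[j --> \oo] --> gap x y.
Proof.
move=> ux vy; rewrite /gap /hs_norm.
apply: (@continuous_cvg _ _ _ _ _ _ (fun t : R => Num.sqrt t)).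
  exact: sqrt_continuous.
apply: cvg_sumr => i; apply: cvg_sumr => l.
have E (a b : 'cV[R]_d) : (a *m a^T - b *m b^T) i l = a i 0 * a l 0 - b i 0 * b l 0.
  by rewrite !mxE !big_ord1 !mxE.
under eq_fun do rewrite E expr2; rewrite E expr2.
have cE : u j i 0 * u j l 0 - v j i 0 * v j l 0 @[j --> \oo] -->
   x i 0 * x l 0 - y i 0 * y l 0.
  by apply: cvgB; apply: cvgM.
exact: cvgM.
Qed.

(** Both sides are continuous in [x] and [y], so the uncountable intersection is
    one over the countably many rational sparse vectors. *)
Lemma measurable_sparse_event (disp : measure_display) (O : measurableType disp)
    (A : 'I_n -> O -> 'M[R]_d) (C : R) :
  (forall i x, bdmeas (fun w => bil (A i w) x x)) ->
  measurable [set w | forall x y, sparse k x -> sparse k y ->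
    C * gap x y <= \sum_i `|bil (A i w) x x - bil (A i w) y y|].
Proof.
move=> bA.
pose F (p : nat) : set O :=
  if unpickle p is Some (g, g') then
    [set w | sparse k (ratvec g) -> sparse k (ratvec g') ->
    C * gap (ratvec g) (ratvec g') <=
    \sum_i `|bil (A i w) (ratvec g) (ratvec g) - bil (A i w) (ratvec g') (ratvec g')|]
  else setT.
rewrite (_ : [set w | _] = \bigcap_p F p).
  apply: bigcapT_measurable => p; rewrite /F; case: unpickle => [[g g']|//].
  have [gs|gs] := boolP (sparse k (ratvec g)); last first.
    by rewrite (_ : [set w | _] = setT)//; apply/seteqP; split.
  have [gs'|gs'] := boolP (sparse k (ratvec g')); last first.
    by rewrite (_ : [set w | _] = setT)//; apply/seteqP; split.
  rewrite (_ : [set w | _] = [set w | C * gap (ratvec g) (ratvec g') <=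
    \sum_i `|bil (A i w) (ratvec g) (ratvec g) - bil (A i w) (ratvec g') (ratvec g')|]).
    have bS : bdmeas (fun w => \sum_i `|bil (A i w) (ratvec g) (ratvec g)
        - bil (A i w) (ratvec g') (ratvec g')|).
      by apply: bdmeas_sum => i; apply: bdmeas_norm; exact: bdmeasB.
    rewrite -[X in measurable X]setTI.
    exact: measurable_fun_le (measurable_cst _) bS.1.
  by apply/seteqP; split=> w /=; [exact|move=> h _ _].
apply/seteqP; split=> w.
  by move=> H p _; rewrite /F; case: unpickle => [[g g'] /=|//]; exact: H.
move=> H x y xk yk.
have [u [u0 ux]] := ratvec_seq x; have [v [v0 vy]] := ratvec_seq y.
have lim1 : C * gap (ratvec (u j)) (ratvec (v j)) @[j --> \oo] --> C * gap x y.
  by apply: cvgM; [exact: cvg_cst|exact: gap_cvg].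
have lim2 : \sum_i `|bil (A i w) (ratvec (u j)) (ratvec (u j))
     - bil (A i w) (ratvec (v j)) (ratvec (v j))| @[j --> \oo] -->
   \sum_i `|bil (A i w) x x - bil (A i w) y y|.
  apply: cvg_sumr => i; apply: cvg_norm; apply: cvgB; exact: bil_cvg.
apply: (ler_cvg_to lim1 lim2); apply: nearW => j.
have := H (pickle (u j, v j)) I; rewrite /F pickleK /=; apply.
  exact: sparse_ratvec xk (u0 j).
exact: sparse_ratvec yk (v0 j).
Qed.

End EventMeasurability.

(** * Union bound over the nets *)

Section Assembly.
Context (R : realType).

Lemma union_bound2 (disp : measure_display) (O : measurableType disp)
    (P : probability O R) (E : set O) (I1 I2 : finType) (Q1 : {set I1}) (Q2 : {set I2})
    (A1 : I1 -> set O) (A2 : I2 -> set O) (p1 p2 : R) :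
  measurable E -> (forall i, measurable (A1 i)) -> (forall i, measurable (A2 i)) ->
  (forall w, (forall i, i \in Q1 -> ~ A1 i w) -> (forall i, i \in Q2 -> ~ A2 i w) -> E w) ->
  (forall i, i \in Q1 -> fine (P (A1 i)) <= p1) ->
  (forall i, i \in Q2 -> fine (P (A2 i)) <= p2) ->
  1 - (#|Q1|%:R * p1 + #|Q2|%:R * p2) <= fine (P E).
Proof.
move=> mE mA1 mA2 cover h1 h2.
have bI (A : set O) : measurable A -> bdmeas (\1_A : O -> R) by exact: bdmeas_indic.
have bS1 : bdmeas (fun w => \sum_(i in Q1) \1_(A1 i) w : R).
  under eq_fun do rewrite big_mkcond; apply: bdmeas_sum => i.
  by case: (i \in Q1); [exact: bI|exact: bdmeas_cst].
have bS2 : bdmeas (fun w => \sum_(i in Q2) \1_(A2 i) w : R).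
  under eq_fun do rewrite big_mkcond; apply: bdmeas_sum => i.
  by case: (i \in Q2); [exact: bI|exact: bdmeas_cst].
have ind0 (A : set O) w : 0 <= \1_A w :> R by rewrite indicE.
have : 1 <= \int[P]_w (\1_E w + (\sum_(i in Q1) \1_(A1 i) w + \sum_(i in Q2) \1_(A2 i) w)).
  rewrite -[leLHS](Ex_cst P); apply: le_Ex; first exact: bdmeas_cst.
    by apply: bdmeasD; [exact: bI|exact: bdmeasD].
  move=> w; have s1 : 0 <= \sum_(i in Q1) \1_(A1 i) w :> R by apply: sumr_ge0.
  have s2 : 0 <= \sum_(i in Q2) \1_(A2 i) w :> R by apply: sumr_ge0.
  have [Ew|NEw] := pselect (E w).
    by rewrite indicE mem_set// lerDl addr_ge0.
  have [[i [iQ Ai]]|N1] := pselect (exists i, i \in Q1 /\ A1 i w).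
    suff : 1 <= \sum_(i in Q1) \1_(A1 i) w :> R by have := ind0 E w; lra.
    by rewrite (bigD1 i)//= indicE mem_set// lerDl sumr_ge0.
  have [[i [iQ Ai]]|N2] := pselect (exists i, i \in Q2 /\ A2 i w).
    suff : 1 <= \sum_(i in Q2) \1_(A2 i) w :> R by have := ind0 E w; lra.
    by rewrite (bigD1 i)//= indicE mem_set// lerDl sumr_ge0.
  exfalso; apply: NEw; apply: cover => i iQ Ai; [apply: N1|apply: N2]; by exists i.
rewrite ExD; [|exact: bI|exact: bdmeasD].
rewrite ExD// Ex_indic//.
have e1 : \int[P]_w \sum_(i in Q1) \1_(A1 i) w <= #|Q1|%:R * p1.
  under eq_Rintegral do rewrite big_mkcond.
  rewrite Ex_sum; last by move=> i; case: (i \in Q1); [exact: bI|exact: bdmeas_cst].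
  rewrite mulr_natl -sumr_const [leRHS]big_mkcond; apply: ler_sum => i _.
  case: (boolP (i \in Q1)) => iQ; [by rewrite Ex_indic// h1|by rewrite Ex_cst].
have e2 : \int[P]_w \sum_(i in Q2) \1_(A2 i) w <= #|Q2|%:R * p2.
  under eq_Rintegral do rewrite big_mkcond.
  rewrite Ex_sum; last by move=> i; case: (i \in Q2); [exact: bI|exact: bdmeas_cst].
  rewrite mulr_natl -sumr_const [leRHS]big_mkcond; apply: ler_sum => i _.
  case: (boolP (i \in Q2)) => iQ; [by rewrite Ex_indic// h2|by rewrite Ex_cst].
lra.
Qed.

Definition log_dim (d k : nat) : R := k%:R * ln (expR 1 * d%:R / k%:R).

Lemma log_dimE d k : (0 < k <= d)%N ->
  log_dim d k = k%:R + k%:R * ln (d%:R / k%:R) /\ 0 <= ln (d%:R / k%:R : R).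
Proof.
move=> /andP[k0 kd]; have kR : 0 < k%:R :> R by rewrite ltr0n.
have dR : 0 < d%:R :> R by rewrite ltr0n (leq_trans k0).
split; last by rewrite ln_ge0// ler_pdivlMr// mul1r ler_nat.
rewrite /log_dim -mulrA lnM ?posrE ?expR_gt0 ?divr_gt0// expRK; ring.
Qed.

Lemma log_dim_ge1 d k : (0 < k <= d)%N -> 1 <= log_dim d k.
Proof.
move=> kd; have [-> l0] := log_dimE kd; have /andP[k0 _] := kd.
have : 1 <= k%:R :> R by rewrite ler1n.
by have := mulr_ge0 (ler0n R k) l0; lra.
Qed.

(** The weight [la = k / d] of a nonzero coordinate balances [la ^- (2 * k)] against
    [expR (2 * la * d)]. *)
Lemma card_lnet_log (M d k : nat) (h : R) : (0 < k <= d)%N -> 0 < h ->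
  #|@lnet R d M (2 * k) ((2 * k)%:R / h ^+ 2)|%:R
  <= expR ((2 / h ^+ 2 + 2) * log_dim d k).
Proof.
move=> kd h0; have [-> l0] := log_dimE kd; have /andP[k0 kd'] := kd.
have kR : 0 < k%:R :> R by rewrite ltr0n.
have dR : 0 < d%:R :> R by rewrite ltr0n (leq_trans k0).
have la : 0 < (k%:R / d%:R : R) <= 1.
  by rewrite divr_gt0//= ler_pdivrMr// mul1r ler_nat.
apply: le_trans (@card_lnet R d M (2 * k)%N _ (k%:R / d%:R) la) _.
rewrite invf_div -{1}[d%:R / k%:R]lnK ?posrE ?divr_gt0//.
rewrite -expRM_natl -!expRD ler_expR.
have -> : 2 * (k%:R / d%:R) * d%:R = 2 * k%:R :> R by field; rewrite gt_eqF.
rewrite natrM; set L := ln _ in l0 *.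
have h20 : 0 <= 2 / h ^+ 2 by rewrite divr_ge0// exprn_ge0// ltW.
have kL : 0 <= k%:R * L by rewrite mulr_ge0// ltW.
have := mulr_ge0 h20 kL.
have -> : 2%:R * k%:R / h ^+ 2 = (2 / h ^+ 2) * k%:R by ring.
by rewrite mulrDl !mulrDr; lra.
Qed.

(** Both squares are polynomials in the Gram matrix of [x] and [y]; their
    difference is twice the Cauchy-Schwarz defect. *)
Lemma gap_le d (x y : 'cV[R]_d) : gap x y <= vnorm (x + y) * vnorm (x - y).
Proof.
rewrite /gap /hs_norm -[leRHS]ger0_norm ?mulr_ge0 ?vnorm_ge0// -sqrtr_sqr.
apply: ler_wsqrtr; rewrite exprMn !vnorm_sqr.
have -> : \sum_i \sum_j (x *m x^T - y *m y^T) i j ^+ 2 =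
    dot x x ^+ 2 - 2 * dot x y ^+ 2 + dot y y ^+ 2.
  have sE (a b : 'cV[R]_d) : dot a b ^+ 2 =
      \sum_i \sum_j (a i 0 * b i 0 * (a j 0 * b j 0)).
    by rewrite expr2 {1}dotE mulr_suml; apply: eq_bigr => i _; rewrite dotE mulr_sumr.
  rewrite !sE mulr_sumr -sumrB -big_split/=; apply: eq_bigr => i _.
  rewrite mulr_sumr -sumrB -big_split/=; apply: eq_bigr => j _.
  by rewrite !mxE !big_ord1 !mxE; ring.
have := sqr_ge0 (dot x x - dot y y).
have := cauchy_schwarz (x + y) (x - y).
rewrite !(dotBl, dotBr, dotDl, dotDr) (dotC y x) => h1 h2.
have h3 := cauchy_schwarz x y.
set p := dot x x in h1 h2 h3 *; set q := dot y y in h1 h2 h3 *; set t := dot x y in h1 h2 h3 *.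
nra.
Qed.

(** The universal constants. Chernoff's bound at a net point has exponent [rate],
    and guarantees that the mean over the sample is at least [level]. The bound 540
    on quadratic forms fixes the mesh and the range of the shifts, and [entropy]
    bounds the logarithm of the size of the net of that mesh, in units of
    [log_dim]. The three terms of [sample_const] pay for the net of mesh 1/4, for
    the fine net with its shifts, and for adding the two failure probabilities. *)
Definition rate : R := pz_slope R / 16.
Definition level : R := rate / 2.
Definition fine_mesh : R := level / (16 * 540).
Definition shift_code : nat := Num.truncn (16 * 540 / level).
Definition entropy : R := 2 / fine_mesh ^+ 2 + 2.
Definition sample_const : R :=
  34 + 2 / rate * (2 * entropy + #|code shift_code|%:R) + 4 / rate.

Lemma rate_gt0 : 0 < rate.
Proof. by rewrite divr_gt0// pz_slope_gt0. Qed.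

Lemma rate_le1 : rate <= 1.
Proof. by have := pz_slope_le1 R; rewrite /rate; lra. Qed.

Lemma level_itv : 0 < level <= 1.
Proof. by rewrite /level; have := rate_gt0; have := rate_le1; lra. Qed.

Lemma fine_mesh_gt0 : 0 < fine_mesh.
Proof.
have /andP[l0 _] := level_itv; apply: divr_gt0; first exact: l0.
by rewrite -natrM ltr0n muln_gt0.
Qed.

Lemma entropy_ge0 : 0 <= entropy.
Proof. by rewrite addr_ge0// divr_ge0// exprn_ge0// ltW// fine_mesh_gt0. Qed.

Lemma tail_const_le : tail_const R <= expR 6.
Proof.
have -> : 6 = 3 + 3 :> R by ring.
rewrite /tail_const (expRD 3 3) ler_wpM2r ?expR_ge0//.
have -> : 3 = 3%:R * 1 :> R by rewrite mulr1.
rewrite expRM_natl; have e2 : 2 <= expR 1 :> R by have := @expR_ge1Dx R 1; lra.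
have -> : 8 = 2 ^+ 3 :> R by rewrite !exprS expr0; ring.
by rewrite lerXn2r ?nnegrE ?expR_ge0.
Qed.

Section Sample.
Context (m d k n : nat) (hm : (0 < m)%N) (hmd : (m < d)%N) (hk : (0 < k <= d)%N).
Local Notation gr := (gr_borel R (ltnW hmd)).

Let K2 := (2 * k)%N.
Let K2_gt0 : (0 < K2)%N. Proof. by rewrite muln_gt0; case/andP: hk. Qed.
Let q := minn m (d - m).
Let q1 : 1 <= Num.sqrt q%:R :> R.
Proof.
rewrite -[leLHS]sqrtr1; apply: ler_wsqrtr.
by rewrite ler1n leq_min hm subn_gt0.
Qed.
Let m0 : 0 < m%:R :> R. Proof. by rewrite ltr0n. Qed.

Definition M1 : nat := Num.truncn (Num.sqrt K2%:R / 4^-1 : R).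
Definition M2 : nat := Num.truncn (Num.sqrt K2%:R / fine_mesh).
Definition pt1 z : 'cV[R]_d := @lpt R d M1 (4^-1 / Num.sqrt K2%:R) z.
Definition pt2 z : 'cV[R]_d := @lpt R d M2 (fine_mesh / Num.sqrt K2%:R) z.
Definition net1 := @lnet R d M1 K2 (K2%:R / 4^-1 ^+ 2).
Definition net2 := @lnet R d M2 K2 (K2%:R / fine_mesh ^+ 2).

(** A net point is bad for the sample when the sum of these functions over the
    sample is nonnegative. *)
Definition bad1 (y : 'cV[R]_d) (v : gr) : R := 30^-1 * `|bil (Dmat v) y y| - 9.
Definition bad2 (s : R) (y y' : 'cV[R]_d) (v : gr) : R :=
  2 * rate - 4 * `|s + bil (Dmat v) y y'|.

(** [x^T A x - y^T A y] is the bilinear form of [A] at [x + y] and [x - y]; after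
    normalising these vectors it is, up to a factor at least [1 / m], that of
    [Dmat] plus a shift common to the whole sample. *)
Lemma sparse_bound_of_nets (v : 'I_n -> gr) :
  (forall z, z \in net1 -> vnorm (pt1 z) <= 1 -> \sum_i bad1 (pt1 z) (v i) < 0) ->
  (forall z w (o : code shift_code), z \in net2 -> w \in net2 ->
     1 / 2 <= vnorm (pt2 z) <= 1 -> 1 / 2 <= vnorm (pt2 w) <= 1 ->
     \sum_i bad2 (level / 8 * cval R o) (pt2 z) (pt2 w) (v i) < 0) ->
  forall x y : 'cV[R]_d, sparse k x -> sparse k y ->
  level / 2 / m%:R * n%:R * gap x y
  <= \sum_i `|bil (scaled_proj (v i)) x x - bil (scaled_proj (v i)) y y|.
Proof.
move=> h1 h2 x y xk yk.
have DT i : (Dmat (v i))^T = Dmat (v i) := Dmat_tr (v i).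
have hB : quad_bound K2 (fun i => Dmat (v i)) (540 * n%:R).
  have -> : 540 * n%:R = 2 * (270 * n%:R) :> R by ring.
  apply: (quad_bound_of_net DT K2_gt0 (Num.Theory.truncnS_gt _)) => z zN /= y1.
  have := h1 z zN y1; rewrite /bad1 sumrB sumr_const card_ord -[9 *+ n]mulr_natr.
  rewrite -mulr_sumr -/(Phi (fun i => Dmat (v i)) (pt1 z) (pt1 z)) -/(pt1 z); lra.
pose a := x + y; pose b := x - y.
have AE (i : 'I_n) : bil (scaled_proj (v i)) x x - bil (scaled_proj (v i)) y y
   = d%:R / m%:R * bil (pr (v i)) a b.
  have sE u w : bil (scaled_proj (v i)) u w = d%:R / m%:R * bil (pr (v i)) u w.
    by rewrite /bil /scaled_proj -scalemxAr -scalemxAl mxE.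
  rewrite !sE /a /b !(bilBr, bilDl) (bilC y x (proj_tr (pr_isproj (v i)))); ring.
under eq_bigr do rewrite AE.
have R0 : 0 <= \sum_i `|d%:R / m%:R * bil (pr (v i)) a b| by apply: sumr_ge0.
have gl : gap x y <= vnorm a * vnorm b := gap_le x y.
have /andP[l0 l1] := level_itv.
have n0 : 0 <= n%:R :> R := ler0n _ _.
have pre : 0 <= level / 2 / m%:R * n%:R.
  by rewrite mulr_ge0// divr_ge0 ?(ltW m0)// divr_ge0// (ltW l0).
have [ab0|ab0] := eqVneq (vnorm a * vnorm b) 0.
  by apply: le_trans R0; rewrite mulr_ge0_le0// -ab0.
have /norP[a0 b0] : ~~ ((vnorm a == 0) || (vnorm b == 0)) by rewrite -mulf_eq0.
have a0' : a != 0 by rewrite -vnorm_eq0.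
have b0' : b != 0 by rewrite -vnorm_eq0.
set e := (vnorm a)^-1 *: a; set f := (vnorm b)^-1 *: b.
pose S := (supp x :|: supp y)%SET.
have Sk : (#|S| <= K2)%N.
  rewrite /K2 mul2n -addnn; apply: leq_trans (leq_add xk yk).
  by rewrite cardsU leq_subr.
have xS : supp x \subset S by exact: finset.subsetUl.
have yS : supp y \subset S by exact: finset.subsetUr.
have eS : supp e \subset S by apply: suppZ; exact: suppD.
have fS : supp f \subset S by apply: suppZ; exact: suppB.
have e1 : vnorm e = 1 by rewrite /vnorm (unit_vec a0') sqrtr1.
have f1 : vnorm f = 1 by rewrite /vnorm (unit_vec b0') sqrtr1.
pose s := m%:R * dot e f / Num.sqrt q%:R.
have key : level / 2 * n%:R <= \sum_i `|s + bil (Dmat (v i)) e f|.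
  apply: (@lower_bound_of_net R d n K2 (fun i => Dmat (v i)) DT M2 shift_code 540 level S) => //.
  - exact: level_itv.
  - exact: ler1n.
  - exact: Num.Theory.truncnS_gt.
  - exact: Num.Theory.truncnS_gt.
  move=> z w o zN wN /= z1 w1.
  have := h2 z w o zN wN z1 w1.
  rewrite /bad2 sumrB sumr_const card_ord -[_ *+ n]mulr_natr -mulr_sumr.
  rewrite /level; lra.
have E (i : 'I_n) : `|d%:R / m%:R * bil (pr (v i)) a b| =
   vnorm a * vnorm b * (Num.sqrt q%:R / m%:R) * `|s + bil (Dmat (v i)) e f|.
  have -> : d%:R / m%:R * bil (pr (v i)) a b =
     vnorm a * vnorm b * (Num.sqrt q%:R / m%:R) * (s + bil (Dmat (v i)) e f).
    rewrite {1}(unit_vecK a0') {1}(unit_vecK b0') bilZl bilZr -/e -/f.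
    rewrite bil_Dmat -/q /s; have q0 : Num.sqrt q%:R != 0 :> R.
      by rewrite gt_eqF// (lt_le_trans ltr01 q1).
    by field; rewrite q0 gt_eqF.
  rewrite normrM ger0_norm//; apply: mulr_ge0.
    by rewrite mulr_ge0 ?vnorm_ge0.
  by rewrite divr_ge0 ?(ltW m0)// (le_trans ler01 q1).
under eq_bigr do rewrite E.
rewrite -mulr_sumr.
apply: (@le_trans _ _ (level / 2 / m%:R * n%:R * (vnorm a * vnorm b))).
  by rewrite ler_wpM2l.
have -> : level / 2 / m%:R * n%:R * (vnorm a * vnorm b) =
   vnorm a * vnorm b * (1 / m%:R) * (level / 2 * n%:R) by ring.
have m1 : 0 <= 1 / m%:R :> R by rewrite divr_ge0// ltW.
have ab : 0 <= vnorm a * vnorm b by rewrite mulr_ge0 ?vnorm_ge0.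
apply: ler_pM => //.
- by rewrite mulr_ge0.
- by rewrite mulr_ge0// divr_ge0// ltW.
- by rewrite ler_wpM2l// ler_wpM2r// invr_ge0 ltW.
Qed.

Context (sigma : probability gr R) (hsigma : is_haar sigma)
  (dO : measure_display) (O : measurableType dO) (P : probability O R)
  (V : 'I_n -> {mfun O >-> gr})
  (hV : forall (i : 'I_n) (B : set gr), measurable B -> distribution P (V i) B = sigma B)
  (indV : mutually_independent P V).

Lemma bdmeas_bad1 y : bdmeas (bad1 y).
Proof.
apply: bdmeasB; last exact: bdmeas_cst.
by apply: bdmeasZ; apply: bdmeas_norm; exact: bdmeas_Dmat.
Qed.

Lemma bdmeas_bad2 s y y' : bdmeas (bad2 s y y').
Proof.
apply: bdmeasB; first exact: bdmeas_cst.
apply: bdmeasZ; apply: bdmeas_norm; apply: bdmeasD; first exact: bdmeas_cst.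
exact: bdmeas_Dmat.
Qed.

(** The exponent -2 is 1 - 9 + 6: discretisation, threshold and tail constant. *)
Lemma prob_bad1 y : vnorm y <= 1 ->
  fine (P [set w | 0 <= \sum_i bad1 y (V i w)]) <= expR (- (2 * n%:R)).
Proof.
move=> y1.
have h : \int[sigma]_v expR (bad1 y v) <= expR (- 9) * tail_const R.
  rewrite /bad1; under eq_Rintegral do rewrite expRD mulrC.
  rewrite ExZ; last exact: bdmeas_expR_norm.
  by rewrite ler_wpM2l ?expR_ge0//; exact: haar_tail.
apply: le_trans (chernoff hV indV (bdmeas_bad1 y) ltr01 h) _.
have -> : - (2 * n%:R) = n%:R * (- 2) :> R by ring.
rewrite (expRM_natl n) lerXn2r ?nnegrE ?expR_ge0 ?mulr_ge0 ?expR_ge0//.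
apply: (@le_trans _ _ (expR 1 * (expR (- 9) * expR 6))).
  by rewrite !ler_wpM2l ?expR_ge0 ?tail_const_le.
by rewrite -!expRD ler_expR; lra.
Qed.

(** The exponent is 1 + 2 - 4 times [rate]: discretisation, threshold and the
    small-ball gain [pz_slope / 4 = 4 * rate]. *)
Lemma prob_bad2 s y y' : 1 / 2 <= vnorm y <= 1 -> 1 / 2 <= vnorm y' <= 1 ->
  fine (P [set w | 0 <= \sum_i bad2 s y y' (V i w)]) <= expR (- (rate * n%:R)).
Proof.
move=> y1 y1'.
have h : \int[sigma]_v expR (bad2 s y y' v) <= expR (2 * rate) * (1 - pz_slope R / 4).
  rewrite /bad2; under eq_Rintegral do rewrite expRD.
  rewrite ExZ.
    by rewrite ler_wpM2l ?expR_ge0//; exact: haar_small_ball_half.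
  apply: bdmeas_expR; apply: bdmeasN; apply: bdmeasZ; apply: bdmeas_norm.
  by apply: bdmeasD; [exact: bdmeas_cst|exact: bdmeas_Dmat].
apply: le_trans (chernoff hV indV (bdmeas_bad2 s y y') rate_gt0 h) _.
have -> : - (rate * n%:R) = n%:R * (- rate) :> R by ring.
rewrite (expRM_natl n) lerXn2r ?nnegrE ?expR_ge0 ?mulr_ge0 ?expR_ge0//.
  by have := pz_slope_le1 R; lra.
apply: (@le_trans _ _ (expR rate * (expR (2 * rate) * expR (- (4 * rate))))).
  rewrite !ler_wpM2l ?expR_ge0//; apply: le_trans (expR_ge1Dx _).
  by rewrite /rate; lra.
by rewrite -!expRD ler_expR; lra.
Qed.

Lemma measurable_bad (f : gr -> R) : bdmeas f ->
  measurable [set w : O | 0 <= \sum_i f (V i w)].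
Proof.
move=> bf; rewrite -[X in measurable X]setTI.
exact: measurable_fun_le (measurable_cst _) (bdmeas_sum_V V bf).1.
Qed.

(** Once [n] exceeds [sample_const * log_dim d k], the number of net points times the
    failure probability at one of them is still exponentially small in [n]. *)
Lemma prob_sparse_event (E : set O) : measurable E ->
  (forall w, (forall x y : 'cV[R]_d, sparse k x -> sparse k y ->
     level / 2 / m%:R * n%:R * gap x y
     <= \sum_i `|bil (scaled_proj (V i w)) x x - bil (scaled_proj (V i w)) y y|) -> E w) ->
  sample_const * log_dim d k <= n%:R ->
  1 - expR (- (rate / 4 * n%:R)) <= fine (P E).
Proof.
move=> mE cover hn.
pose F2 : finType := ({ffun 'I_d -> code M2} * {ffun 'I_d -> code M2} * code shift_code)%type.
pose Q1 : {set {ffun 'I_d -> code M1}} := [set z in net1 | vnorm (pt1 z) <= 1]%SET.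
pose Q2 : {set F2} := [set p in finset.setX (finset.setX net2 net2) [set: code shift_code] |
  (1 / 2 <= vnorm (pt2 p.1.1) <= 1) && (1 / 2 <= vnorm (pt2 p.1.2) <= 1)]%SET.
pose A1 z : set O := [set w | 0 <= \sum_i bad1 (pt1 z) (V i w)].
pose A2 (p : F2) : set O :=
  [set w | 0 <= \sum_i bad2 (level / 8 * cval R p.2) (pt2 p.1.1) (pt2 p.1.2) (V i w)].
have ub : 1 - (#|Q1|%:R * expR (- (2 * n%:R)) + #|Q2|%:R * expR (- (rate * n%:R)))
   <= fine (P E).
  apply: (@union_bound2 _ _ P E _ _ Q1 Q2 A1 A2) => //.
  - by move=> z; apply: measurable_bad; exact: bdmeas_bad1.
  - by move=> p; apply: measurable_bad; exact: bdmeas_bad2.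
  - move=> w hw1 hw2; apply: cover; apply: sparse_bound_of_nets.
      move=> z zN z1; rewrite ltNge; apply/negP; apply: hw1.
      by rewrite finset.inE zN.
    move=> z z' o zN zN' z1 z1'; rewrite ltNge; apply/negP.
    apply: (hw2 (z, z', o)).
    by rewrite finset.inE !finset.in_setX zN zN' z1 z1' finset.inE.
  - by move=> z; rewrite finset.inE => /andP[_]; exact: prob_bad1.
  - by move=> p; rewrite finset.inE => /andP[_ /andP[]]; exact: prob_bad2.
apply: le_trans ub; rewrite lerD2l lerN2.
have r0 := rate_gt0; have r1 := rate_le1; have en0 := entropy_ge0.
set l := log_dim d k in hn; have l1 : 1 <= l := log_dim_ge1 hk.
set J : R := #|code shift_code|%:R in hn *; have J0 : 0 <= J := ler0n _ _.
have n0 : 0 <= n%:R :> R := ler0n _ _.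
have nb1 : #|Q1|%:R <= expR (34 * l).
  apply: (@le_trans _ _ #|net1|%:R).
    by rewrite ler_nat; apply: subset_leq_card; apply/fintype.subsetP => z;
      rewrite finset.inE => /andP[].
  have -> : 34 = 2 / 4^-1 ^+ 2 + 2 :> R by field.
  by apply: card_lnet_log.
have nb2 : #|Q2|%:R <= expR ((2 * entropy + J) * l).
  apply: (@le_trans _ _ (#|net2|%:R * #|net2|%:R * J)).
    rewrite /J -!natrM ler_nat -cardsT -!cardsX.
    by apply: subset_leq_card; apply/fintype.subsetP => p; rewrite finset.inE => /andP[].
  have -> : (2 * entropy + J) * l = entropy * l + entropy * l + J * l by ring.
  have h2 := card_lnet_log M2 hk fine_mesh_gt0.
  rewrite !expRD; apply: ler_pM; rewrite ?mulr_ge0 ?ler0n//.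
    by apply: ler_pM; rewrite ?ler0n.
  apply: (@le_trans _ _ (J * l)); first by rewrite ler_peMr.
  by have := expR_ge1Dx (J * l); lra.
have c1 : 34 * l + 2 / rate * ((2 * entropy + J) * l) + 4 / rate * l <= n%:R.
  apply: le_trans hn; rewrite /sample_const -/J !mulrDl.
  by rewrite le_eqVlt; apply/orP; left; apply/eqP; ring.
have t1 : 0 <= 34 * l by rewrite mulr_ge0//; lra.
have t2 : 0 <= 2 / rate * ((2 * entropy + J) * l).
  by apply: mulr_ge0; [rewrite divr_ge0// ltW|apply: mulr_ge0; lra].
have t3 : 4 / rate <= 4 / rate * l by rewrite ler_peMr// divr_ge0// ltW.
have t3' : 0 <= 4 / rate by rewrite divr_ge0// ltW.
have [u1 u2' u3'] : [/\ 34 * l <= n%:R, 2 / rate * ((2 * entropy + J) * l) <= n%:R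
    & 4 / rate <= n%:R].
  move: c1 t1 t2 t3 t3'; set x1 := 34 * l; set x2 := 2 / rate * (_ * l).
  by set x3 := 4 / rate * l; set x4 := 4 / rate => *; split; lra.
have u2 : (2 * entropy + J) * l <= rate / 2 * n%:R.
  have -> : (2 * entropy + J) * l = rate / 2 * (2 / rate * ((2 * entropy + J) * l)).
    by field; rewrite gt_eqF.
  by rewrite ler_wpM2l// divr_ge0// ltW.
have u3 : 1 <= rate / 4 * n%:R.
  have E4 : rate / 4 * (4 / rate) = 1 by field; rewrite gt_eqF.
  by rewrite -[leLHS]E4 ler_wpM2l// divr_ge0// ltW.
have rn : rate * n%:R <= n%:R by rewrite ler_piMl.
have b1 : #|Q1|%:R * expR (- (2 * n%:R)) <= expR (- (rate / 2 * n%:R)).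
  apply: (@le_trans _ _ (expR (34 * l) * expR (- (2 * n%:R)))).
    by rewrite ler_wpM2r ?expR_ge0.
  by rewrite -expRD ler_expR; lra.
have b2 : #|Q2|%:R * expR (- (rate * n%:R)) <= expR (- (rate / 2 * n%:R)).
  apply: (@le_trans _ _ (expR ((2 * entropy + J) * l) * expR (- (rate * n%:R)))).
    by rewrite ler_wpM2r ?expR_ge0.
  by rewrite -expRD ler_expR; lra.
apply: le_trans (lerD b1 b2) _.
have -> : - (rate / 4 * n%:R) = rate / 4 * n%:R + - (rate / 2 * n%:R) by field.
rewrite expRD -mulr2n -[leLHS]mulr_natl ler_wpM2r ?expR_ge0//.
by have := expR_ge1Dx (rate / 4 * n%:R); lra.
Qed.

End Sample.

End Assembly.

(** * Simultaneous lower bound for sparse vectors *)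

Theorem corollary3p15 (R : realType) :
  exists u : nat -> R, (forall m : nat, (0 < m)%N -> 0 < u m) /\
  forall r : R, 0 < r < 1 ->
  exists c C : R, [/\ 0 < c, 0 < C &
  forall (m d k n : nat) (hm : (0 < m)%N) (hmd : (m < d)%N)
    (hk : (0 < k <= d)%N)
    (hn : c * k%:R * ln (expR 1 * d%:R / k%:R) <= n%:R)
    (sigma : probability (gr_borel R (ltnW hmd)) R) (hsigma : is_haar sigma)
    (dO : measure_display) (O : measurableType dO) (P : probability O R)
    (V : 'I_n -> {mfun O >-> gr_borel R (ltnW hmd)})
    (hV : forall (i : 'I_n) (B : set (gr_borel R (ltnW hmd))),
            measurable B -> distribution P (V i) B = sigma B)
    (indV : mutually_independent P V),
  let E := [set w : O | forall x y : 'cV[R]_d, sparse k x -> sparse k y ->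
      u m * (1 - r) * n%:R * hs_norm (x *m x^T - y *m y^T)
      <= \sum_(i < n) `| qform (scaled_proj (V i w)) x
                         - qform (scaled_proj (V i w)) y |] in
  measurable E /\ ((1 - expR (- (C * n%:R)))%:E <= P E)%E].
Proof.
exists (fun m => level R / 2 / m%:R); split.
  move=> m m0; have /andP[l0 _] := level_itv R.
  by apply: divr_gt0; [exact: divr_gt0|rewrite ltr0n].
move=> r /andP[r0 r1]; exists (sample_const R), (rate R / 4); split.
- have ra0 := rate_gt0 R; apply: addr_gt0; last exact: divr_gt0.
  apply: ltr_wpDr => //; apply: mulr_ge0; first by rewrite divr_ge0// ltW.
  by apply: addr_ge0 => //; apply: mulr_ge0 => //; exact: entropy_ge0.
- by rewrite divr_gt0// rate_gt0.
move=> m d k n hm hmd hk hn sigma hsigma dO O P V hV indV E.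
have bA (i : 'I_n) (x : 'cV[R]_d) : bdmeas (fun w => bil (scaled_proj (V i w)) x x).
  rewrite (_ : (fun w => _) = fun w => d%:R / m%:R * bil (pr (V i w)) x x).
    have bb := bdmeas_V V i (@bdmeas_bil R m d (ltnW hmd) x x); exact: bdmeasZ.
  by apply/funext => w; rewrite /bil /scaled_proj -scalemxAr -scalemxAl mxE.
have mE : measurable E.
  exact: (measurable_sparse_event k (level R / 2 / m%:R * (1 - r) * n%:R) bA).
split=> //.
rewrite -(fineK (fin_num_measure P E mE)) lee_fin.
apply: (prob_sparse_event hm hk hsigma hV indV mE); last by rewrite /log_dim mulrA.
move=> w H x y xk yk; apply: le_trans (H x y xk yk).
have /andP[l0 _] := level_itv R.
have g0 : 0 <= gap x y by exact: sqrtr_ge0.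
rewrite -/(gap x y) ler_wpM2r// ler_wpM2r// ler_piMr//; last by lra.
by apply: divr_ge0; [rewrite divr_ge0// ltW|exact: ler0n].
Qed.
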